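(* Let $\alpha,\beta\in\mathbb{R}$, $\eta\in\{1,-1\}$, and let $G_4$ be the connected, simply connected three-dimensional Lie group with left-invariant Lorentzian metric $g$ whose Lie algebra has a pseudo-orthonormal basis $\{\widetilde e_1,\widetilde e_2,\widetilde e_3\}$, with $\widetilde e_3$ timelike, satisfying $$[\widetilde e_1,\widetilde e_2]=-\widetilde e_2+(2\eta-\beta)\widetilde e_3,\quad [\widetilde e_1,\widetilde e_3]=-\beta\widetilde e_2+\widetilde e_3,\quad [\widetilde e_2,\widetilde e_3]=\alpha\widetilde e_1.$$ Let $\nabla^B$ be the Bott connection and $\widetilde\rho^B$ its symmetrized Ricci tensor. Then $(G_4,\nabla^B,\widetilde\rho^B)$ is a quasi-statistical structure if and only if $\alpha=\beta=0$.
   Context: Basis vectors are identified with left-invariant vector fields on the group $G$; $g(\widetilde e_1,\widetilde e_1)=g(\widetilde e_2,\widetilde e_2)=1$, $g(\widetilde e_3,\widetilde e_3)=-1$, and $g(\widetilde e_i,\widetilde e_j)=0$ for $i\ne j$. Let $\nabla^L$ be the Levi-Civita connection of $g$, $D=\mathrm{span}\{\widetilde e_1,\widetilde e_2\}$, $D^\perp=\mathrm{span}\{\widetilde e_3\}$ (distributions on $G$), with associated projections $\pi_D,\pi_{D^\perp}$ of $TG=D\oplus D^\perp$. The Bott connection $\nabla^B$ is the linear connection given by: $\nabla^B_XY=\pi_D(\nabla^L_XY)$ for $X,Y\in\Gamma^\infty(D)$; $\nabla^B_XY=\pi_D([X,Y])$ for $X\in\Gamma^\infty(D^\perp),Y\in\Gamma^\infty(D)$;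 $\nabla^B_XY=\pi_{D^\perp}([X,Y])$ for $X\in\Gamma^\infty(D),Y\in\Gamma^\infty(D^\perp)$; $\nabla^B_XY=\pi_{D^\perp}(\nabla^L_XY)$ for $X,Y\in\Gamma^\infty(D^\perp)$. Curvature: $R^B(X,Y)Z=\nabla^B_X\nabla^B_YZ-\nabla^B_Y\nabla^B_XZ-\nabla^B_{[X,Y]}Z$. Ricci tensor: $\rho^B(X,Y)=-g(R^B(X,\widetilde e_1)Y,\widetilde e_1)-g(R^B(X,\widetilde e_2)Y,\widetilde e_2)+g(R^B(X,\widetilde e_3)Y,\widetilde e_3)$. Symmetrized Ricci tensor: $\widetilde\rho^B(X,Y)=\tfrac12(\rho^B(X,Y)+\rho^B(Y,X))$. For a linear connection $\nabla$ with torsion $T(X,Y)=\nabla_XY-\nabla_YX-[X,Y]$ and a $(0,2)$ tensor field $\omega$, put $(\nabla_X\omega)(Y,Z)=X[\omega(Y,Z)]-\omega(\nabla_XY,Z)-\omega(Y,\nabla_XZ)$. The triple $(G,\nabla,\omega)$ is called a quasi-statistical structure if $(\nabla_X\omega)(Y,Z)-(\nabla_Y\omega)(X,Z)+\omega(T(X,Y),Z)=0$ for all vector fields $X,Y,Z$. *)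

(* Defs.v *)
From HB Require Import structures.
From mathcomp Require Import all_boot all_order all_algebra.
From mathcomp Require Import all_classical all_reals all_analysis.

Set Implicit Arguments.
Unset Strict Implicit.
Unset Printing Implicit Defensive.

Import Order.TTheory GRing.Theory Num.Theory.
Import numFieldNormedType.Exports.

Local Open Scope classical_set_scope.
Local Open Scope ring_scope.

Section SmoothFunctions.
Context {R : realType}.

Definition partial (n : nat) (i : 'I_n) (f : 'rV[R]_n -> R) : 'rV[R]_n -> R :=
  fun x => 'D_(delta_mx 0 i) f x.

(* C^oo on U, only used for open U: all iterated partial derivatives, f        *)
(* included, are differentiable (hence continuous) at the points of U.         *)
Definition smooth_on (n : nat) (U : set 'rV[R]_n) (f : 'rV[R]_n -> R) : Prop :=
  forall (s : seq 'I_n) (x : 'rV[R]_n), U x -> differentiable (foldr (@partial n) f s) x.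

End SmoothFunctions.

(* coord is meaningful on dom only, and param on the open set coord @` dom,    *)
(* where it is the inverse of coord.                                           *)
Record chart (R : realType) (n : nat) (T : topologicalType) := Chart {
  dom : set T;
  coord : T -> 'rV[R]_n;
  param : 'rV[R]_n -> T
}.

Section Charts.
Context {R : realType} {n : nat} {T : topologicalType}.
Implicit Types c : chart R n T.

Definition range_chart c : set 'rV[R]_n := coord c @` dom c.

Definition is_chart c : Prop :=
  [/\ open (dom c), open (range_chart c),
      (forall p, dom c p -> param c (coord c p) = p),
      {within dom c, continuous (coord c)} &
      {within range_chart c, continuous (param c)}].

Definition compatible c c' : Prop :=
  forall j : 'I_n,
    smooth_on [set x | range_chart c x /\ dom c' (param c x)]
              (fun x => coord c' (param c x) 0 j).

End Charts.

(* An arbitrary smooth atlas is used, not a maximal one: smoothness of maps    *)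
(* and of vector fields only depends on the maximal atlas containing it.       *)
Record manifold (R : realType) (n : nat) := Manifold {
  mfd_carrier :> topologicalType;
  atlas : set (chart R n mfd_carrier);
  mfd_hausdorff : hausdorff_space mfd_carrier;
  mfd_second_countable : @second_countable mfd_carrier;
  atlas_chart : forall c, atlas c -> is_chart c;
  atlas_cover : forall p, exists2 c, atlas c & dom c p;
  atlas_compatible : forall c c', atlas c -> atlas c' -> compatible c c'
}.
Arguments atlas {R n} _ _.

Section SimplyConnected.
Context (R : realType) (T : topologicalType).

Definition simply_connected : Prop :=
  connected [set: T] /\
  forall gamma : R -> T,
    {within `[0, 1]%classic, continuous gamma} -> gamma 0 = gamma 1 ->
    exists H : R * R -> T,
      [/\ {within (`[0, 1] `*` `[0, 1])%classic, continuous H},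
          (forall t, `[0, 1]%classic t -> H (0, t) = gamma t),
          (forall t, `[0, 1]%classic t -> H (1, t) = gamma 0),
          (forall s, `[0, 1]%classic s -> H (s, 0) = gamma 0) &
          (forall s, `[0, 1]%classic s -> H (s, 1) = gamma 0)].

End SimplyConnected.

Section VectorFields.
Context {R : realType} {n : nat} {M : manifold R n}.

(* Vector fields are handled through their action on functions.                *)
Local Notation vf := ((M -> R) -> M -> R).

Definition smooth (f : M -> R) : Prop :=
  forall c, atlas M c -> smooth_on (range_chart c) (f \o param c).

(* X is \sum_i a_i d/dx_i with smooth a_i in every chart. The value 0 imposed  *)
(* on non-smooth functions makes Leibniz equality the equality of vector       *)
(* fields; it is preserved by all the operations below.                        *)
Definition vector_field (X : vf) : Prop :=
  (forall f, ~ smooth f -> X f = 0) /\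
  forall c, atlas M c ->
    exists a : 'I_n -> 'rV[R]_n -> R,
      (forall i, smooth_on (range_chart c) (a i)) /\
      forall f x, smooth f -> range_chart c x ->
        X f (param c x) = \sum_(i < n) a i x * partial i (f \o param c) x.

Definition fscale (f : M -> R) (X : vf) : vf := fun h p => f p * X h p.

Definition lie_bracket (X Y : vf) : vf := fun f => X (Y f) - Y (X f).

Definition tensor02 (w : vf -> vf -> M -> R) : Prop :=
  [/\ (forall X Y, vector_field X -> vector_field Y -> smooth (w X Y)),
      (forall f X X' Y, smooth f ->
         vector_field X -> vector_field X' -> vector_field Y ->
         w (fscale f X + X') Y = (fun p => f p * w X Y p) + w X' Y) &
      (forall f X Y Y', smooth f ->
         vector_field X -> vector_field Y -> vector_field Y' ->
         w X (fscale f Y + Y') = (fun p => f p * w X Y p) + w X Y')].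

Definition linear_connection (nabla : vf -> vf -> vf) : Prop :=
  [/\ (forall X Y, vector_field X -> vector_field Y ->
         vector_field (nabla X Y)),
      (forall f X X' Y, smooth f ->
         vector_field X -> vector_field X' -> vector_field Y ->
         nabla (fscale f X + X') Y = fscale f (nabla X Y) + nabla X' Y),
      (forall X Y Y', vector_field X -> vector_field Y -> vector_field Y' ->
         nabla X (Y + Y') = nabla X Y + nabla X Y') &
      (forall f X Y, smooth f -> vector_field X -> vector_field Y ->
         nabla X (fscale f Y) = fscale (X f) Y + fscale f (nabla X Y))].

Definition torsion (nabla : vf -> vf -> vf) (X Y : vf) : vf :=
  nabla X Y - nabla Y X - lie_bracket X Y.

Definition curvature (nabla : vf -> vf -> vf) (X Y Z : vf) : vf :=
  nabla X (nabla Y Z) - nabla Y (nabla X Z) - nabla (lie_bracket X Y) Z.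

Definition cov_deriv (nabla : vf -> vf -> vf) (w : vf -> vf -> M -> R)
    (X Y Z : vf) : M -> R :=
  X (w Y Z) - w (nabla X Y) Z - w Y (nabla X Z).

Definition levi_civita (g : vf -> vf -> M -> R) (nabla : vf -> vf -> vf) :
    Prop :=
  [/\ linear_connection nabla,
      (forall X Y, vector_field X -> vector_field Y -> torsion nabla X Y = 0) &
      (forall X Y Z, vector_field X -> vector_field Y -> vector_field Z ->
         cov_deriv nabla g X Y Z = 0)].

Definition quasi_statistical (nabla : vf -> vf -> vf)
    (w : vf -> vf -> M -> R) : Prop :=
  forall X Y Z, vector_field X -> vector_field Y -> vector_field Z ->
    cov_deriv nabla w X Y Z - cov_deriv nabla w Y X Z
      + w (torsion nabla X Y) Z = 0.

(* Sections of the distribution spanned by the vector fields in s.             *)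
Definition sections_span (s : seq vf) : set vf :=
  [set X | exists f : 'I_(size s) -> M -> R,
     (forall i, smooth (f i)) /\ X = \sum_(i < size s) fscale (f i) s`_i].

(* Projection on D along D', for TM the direct sum of D and D'.                *)
Definition proj_along (D D' : set vf) (X : vf) : vf :=
  xget 0 [set Y | D Y /\ D' (X - Y)].

Definition bott_connection (nablaL : vf -> vf -> vf) (D D' : set vf)
    (nabla : vf -> vf -> vf) : Prop :=
  let piD := proj_along D D' in
  let piD' := proj_along D' D in
  [/\ linear_connection nabla,
      (forall X Y, D X -> D Y -> nabla X Y = piD (nablaL X Y)),
      (forall X Y, D' X -> D Y -> nabla X Y = piD (lie_bracket X Y)),
      (forall X Y, D X -> D' Y -> nabla X Y = piD' (lie_bracket X Y)) &
      (forall X Y, D' X -> D' Y -> nabla X Y = piD' (nablaL X Y))].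

Definition ricci (g : vf -> vf -> M -> R) (e1 e2 e3 : vf)
    (nabla : vf -> vf -> vf) (X Y : vf) : M -> R :=
  - g (curvature nabla X e1 Y) e1 - g (curvature nabla X e2 Y) e2
  + g (curvature nabla X e3 Y) e3.

Definition sym_ricci (g : vf -> vf -> M -> R) (e1 e2 e3 : vf)
    (nabla : vf -> vf -> vf) (X Y : vf) : M -> R :=
  2^-1 *: (ricci g e1 e2 e3 nabla X Y + ricci g e1 e2 e3 nabla Y X).

End VectorFields.

Section Lorentzian.
Context {R : realType} {M : manifold R 3}.
Local Notation vf := ((M -> R) -> M -> R).

(* Signature (2,1): every tangent space has a pseudo-orthonormal basis.        *)
Definition lorentzian (g : vf -> vf -> M -> R) : Prop :=
  [/\ tensor02 g,
      (forall X Y, vector_field X -> vector_field Y -> g X Y = g Y X) &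
      (forall p, exists F : 'I_3 -> vf, (forall i, vector_field (F i)) /\
         forall i j, g (F i) (F j) p =
           if i == j then (if i == ord_max then -1 else 1) else 0)].

(* The last vector is the timelike one.                                        *)
Definition pseudo_orthonormal (g : vf -> vf -> M -> R) (e1 e2 e3 : vf) : Prop :=
  [/\ g e1 e1 = cst 1, g e2 e2 = cst 1 & g e3 e3 = cst (-1)] /\
  [/\ g e1 e2 = 0, g e1 e3 = 0 & g e2 e3 = 0] /\
  [/\ g e2 e1 = 0, g e3 e1 = 0 & g e3 e2 = 0].

End Lorentzian.

Record lie_group (R : realType) (n : nat) := LieGroup {
  lg_mfd :> manifold R n;
  lg_mul : lg_mfd -> lg_mfd -> lg_mfd;
  lg_one : lg_mfd;
  lg_inv : lg_mfd -> lg_mfd;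
  lg_mulA : associative lg_mul;
  lg_mul1 : left_id lg_one lg_mul;
  lg_mulV : left_inverse lg_one lg_inv lg_mul;
  lg_mul_cont : continuous (fun p : lg_mfd * lg_mfd => lg_mul p.1 p.2);
  lg_inv_cont : continuous lg_inv;
  (* R^(n + n) carries the product charts of G * G. *)
  lg_mul_smooth : forall c1 c2 c,
    atlas lg_mfd c1 -> atlas lg_mfd c2 -> atlas lg_mfd c ->
    forall j : 'I_n, @smooth_on R (n + n)
      [set z | [/\ range_chart c1 (lsubmx z), range_chart c2 (rsubmx z) &
         dom c (lg_mul (param c1 (lsubmx z)) (param c2 (rsubmx z)))]]
      (fun z => coord c (lg_mul (param c1 (lsubmx z)) (param c2 (rsubmx z))) 0 j);
  lg_inv_smooth : forall c1 c, atlas lg_mfd c1 -> atlas lg_mfd c ->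
    forall j : 'I_n, smooth_on
      [set x | range_chart c1 x /\ dom c (lg_inv (param c1 x))]
      (fun x => coord c (lg_inv (param c1 x)) 0 j)
}.

Section LeftInvariant.
Context {R : realType} {G : lie_group R 3}.
Local Notation vf := ((G -> R) -> G -> R).

Definition left_invariant (X : vf) : Prop :=
  vector_field X /\
  forall (a : G) (f : G -> R), smooth f ->
    X (fun p => f (lg_mul a p)) = (fun p => X f (lg_mul a p)).

Definition lie_algebra_basis (e1 e2 e3 : vf) : Prop :=
  [/\ left_invariant e1, left_invariant e2 & left_invariant e3] /\
  forall X, left_invariant X ->
    exists! c : R * R * R, X = c.1.1 *: e1 + c.1.2 *: e2 + c.2 *: e3.

Definition left_invariant_metric (g : vf -> vf -> G -> R) : Prop :=
  forall X Y, left_invariant X -> left_invariant Y -> exists k, g X Y = cst k.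

End LeftInvariant.

(* Main.v *)
Require Import Defs.
From mathcomp Require Import all_boot all_order all_algebra.
From mathcomp Require Import all_classical all_reals all_analysis.
From mathcomp Require Import ring lra.
Import Order.TTheory GRing.Theory Num.Theory.
Import numFieldNormedType.Exports.
Local Open Scope classical_set_scope.
Local Open Scope ring_scope.
Set Implicit Arguments.
Unset Strict Implicit.
Unset Printing Implicit Defensive.

(** The equation of a quasi-statistical structure is an identity between tensor
fields: for a linear connection and a tensor field [w], its left-hand side is
linear over smooth functions in each of its three arguments, because the
derivatives of the coefficients cancel. It therefore holds for all vector
fields as soon as it holds for the vectors of a global frame
([quasi_statistical_frame]), and on a left-invariant frame of a Lie group it
becomes a system of polynomial equations in the structure constants.

Two facts make this reduction legitimate. First, a basis of left-invariant
fields is a frame: a combination with constant coefficients that vanishes at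
one point vanishes everywhere by left translation, so the basis is independent
at every point ([lie_algebra_basis_independent]), and Cramer's rule in charts
then gives smooth coefficients to every vector field ([frame_expansion]).
Second, the symmetrized Ricci tensor is a tensor, because the curvature is
([tensor02_sym_ricci]).

On constant combinations of the frame the metric, the bracket and the Bott
connection are bilinear maps with constant coefficients. Metric compatibility
and the absence of torsion determine the components of the Levi-Civita
connection that enter the Bott connection ([bott_basis]). Writing
gamma = 2 eta - beta, the symmetrized Ricci tensor has the components
  (e1, e1): beta gamma - 1,  (e2, e2): alpha gamma - 1,
  (e2, e3) and (e3, e2): alpha / 2,
and all others vanish ([sym_ricci_lcomb]). The defect of the quasi-statistical
equation then only involves the two numbers alpha / 2 - beta and
alpha beta / 2 ([quasi_statistical_defect]). Each of them is a component of the
defect, so the equation says that alpha = 2 beta and alpha beta = 0, that is,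
alpha = beta = 0. *)

(** * Smooth functions on open subsets of R^n *)

(** The difference of the two functions vanishes near [x], so the zero map is
its differential there. *)
Lemma differentiable_near_eq (R : realType) (V W : normedModType R)
    (f g : V -> W) (x : V) :
  (\near x, f x = g x) -> differentiable f x -> differentiable g x.
Proof.
move=> fg df; rewrite -[g](subrK f); apply: differentiableD => //.
set h := g - f.
have h0 : \forall y \near x, h y = 0.
  by apply: filterS fg => y fgy; rewrite /h !fctE fgy subrr.
suff : exists d : {linear V -> W}, continuous d /\
    forall y, h y = h (lim (nbhs x)) + d (y - lim (nbhs x))
                    +o_(y \near x) (y - lim (nbhs x)).
  by move=> /getPex hd; apply/diffP.
exists (@GRing.null_fun V W); split; first exact: cst_continuous.
apply: eqaddoEx => y; rewrite lim_id// (nbhs_singleton h0) /= addr0 add0r.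
move: y; apply/funeqP/eqoP => /= eps eps0.
by apply: filterS h0 => y ->; rewrite normr0 mulr_ge0// ltW.
Qed.

Section SmoothOn.
Context {R : realType} {n : nat} (U : set 'rV[R]_n) (U_open : open U).
Implicit Types (f g : 'rV[R]_n -> R) (i : 'I_n) (k : nat).

(** Bounding the order allows induction: the product and quotient rules express
the derivatives of [f * g] and [f^-1] through products whose factors can be
differentiated one time less. *)
Fixpoint differentiable_upto k f : Prop :=
  (forall x, U x -> differentiable f x) /\
  if k is k'.+1 then forall i, differentiable_upto k' (partial i f) else True.

Lemma smooth_on_upto f : smooth_on U f <-> forall k, differentiable_upto k f.
Proof.
split=> [fU k|fU s].
  elim: k f fU => [|k IH] f fU; split=> //; try by move=> x; exact: (fU [::]).
  by move=> i; apply: IH => s x Ux; have := fU (rcons s i) x Ux;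
    rewrite foldr_rcons.
have {fU} : differentiable_upto (size s) f by [].
elim/last_ind: s f => [|s i IH] f; first by move=> [df _] x; exact: df.
by rewrite size_rcons foldr_rcons => -[_ /(_ i) fi]; exact: IH.
Qed.

Lemma smooth_on_differentiable f x :
  smooth_on U f -> U x -> differentiable f x.
Proof. by move=> fU; exact: (fU [::]). Qed.

Lemma smooth_on_partial i f : smooth_on U f -> smooth_on U (partial i f).
Proof.
by move=> fU s x Ux; have := fU (rcons s i) x Ux; rewrite foldr_rcons.
Qed.

Lemma partial_eq_on i f g x : {in U, f =1 g} -> U x ->
  partial i f x = partial i g x.
Proof.
move=> fg Ux; apply: near_eq_derive.
have : \forall y \near x, U y by exact: open_nbhs_nbhs.
by apply: filterS => y Uy; apply: fg; rewrite inE.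
Qed.

Lemma differentiable_upto_eq k f g : {in U, f =1 g} ->
  differentiable_upto k f -> differentiable_upto k g.
Proof.
elim: k f g => [|k IH] f g fg [df pf]; split=> //; last first.
  by move=> i; apply: IH (pf i) => x; rewrite inE => Ux; apply: partial_eq_on.
all: move=> x Ux; apply: differentiable_near_eq (df x Ux).
all: have : \forall y \near x, U y by exact: open_nbhs_nbhs.
all: by apply: filterS => y Uy; apply: fg; rewrite inE.
Qed.

Lemma smooth_on_eq f g : {in U, f =1 g} -> smooth_on U f -> smooth_on U g.
Proof.
move=> fg /smooth_on_upto fU; apply/smooth_on_upto => k.
exact: differentiable_upto_eq (fU k).
Qed.

Lemma differentiable_uptoW k f :
  differentiable_upto k.+1 f -> differentiable_upto k f.
Proof.
by elim: k f => [|k IH] f [df pf]; split=> // i; apply: IH.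
Qed.

Lemma partialD i f g x : differentiable f x -> differentiable g x ->
  partial i (f + g) x = partial i f x + partial i g x.
Proof. by move=> df dg; rewrite /partial deriveD//; exact: diff_derivable. Qed.

Lemma partialM i f g x : differentiable f x -> differentiable g x ->
  partial i (f * g) x = f x * partial i g x + g x * partial i f x.
Proof. by move=> df dg; rewrite /partial deriveM//; exact: diff_derivable. Qed.

Lemma partial_cst i (c : R) : partial i (cst c : 'rV[R]_n -> R) = cst 0.
Proof. by apply/funext => x; rewrite /partial derive_cst. Qed.

Lemma differentiable_upto_cst k (c : R) : differentiable_upto k (cst c).
Proof.
elim: k c => [|k IH] c /=; split=> // i.
by rewrite partial_cst.
Qed.

Lemma differentiable_uptoD k f g : differentiable_upto k f ->
  differentiable_upto k g -> differentiable_upto k (f + g).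
Proof.
elim: k f g => [|k IH] f g [df pf] [dg pg].
  by split=> // x Ux; apply: differentiableD; [exact: df|exact: dg].
split=> [x Ux|i]; first by apply: differentiableD; [exact: df|exact: dg].
apply: (differentiable_upto_eq _ (IH _ _ (pf i) (pg i))) => x.
by rewrite inE => Ux; rewrite partialD//; [exact: df|exact: dg].
Qed.

Lemma differentiable_uptoM k f g : differentiable_upto k f ->
  differentiable_upto k g -> differentiable_upto k (f * g).
Proof.
elim: k f g => [|k IH] f g fk gk.
  have [df _] := fk; have [dg _] := gk; split=> // x Ux.
  by apply: differentiableM; [exact: df|exact: dg].
have [df pf] := fk; have [dg pg] := gk; split=> [x Ux|i].
  by apply: differentiableM; [exact: df|exact: dg].
have fk' := differentiable_uptoW fk; have gk' := differentiable_uptoW gk.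
apply: (differentiable_upto_eq _
  (differentiable_uptoD (IH _ _ fk' (pg i)) (IH _ _ gk' (pf i)))) => x.
by rewrite inE => Ux; rewrite partialM//; [exact: df|exact: dg].
Qed.

Lemma differentiable_uptoV k f : (forall x, U x -> f x != 0) ->
  differentiable_upto k f -> differentiable_upto k (fun x => (f x)^-1).
Proof.
move=> f0; elim: k f f0 => [|k IH] f f0 fk.
  have [df _] := fk; split=> // x Ux.
  by apply: differentiableV; [exact: df|exact: f0].
have [df pf] := fk; split=> [x Ux|i].
  by apply: differentiableV; [exact: df|exact: f0].
have fk' := differentiable_uptoW fk.
have vk := IH f f0 fk'.
apply: (differentiable_upto_eq _ (differentiable_uptoM
  (differentiable_upto_cst k (-1))
  (differentiable_uptoM (differentiable_uptoM vk vk) (pf i)))) => x.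
rewrite inE => Ux; rewrite /partial deriveV; first last.
- exact/diff_derivable/df.
- exact: f0.
by rewrite !fctE mulN1r /GRing.scale/= mulNr -invfM -expr2.
Qed.

Lemma smooth_on_cst (c : R) : smooth_on U (cst c).
Proof. by apply/smooth_on_upto => k; exact: differentiable_upto_cst. Qed.

Lemma smooth_onD f g : smooth_on U f -> smooth_on U g -> smooth_on U (f + g).
Proof.
move=> /smooth_on_upto fU /smooth_on_upto gU; apply/smooth_on_upto => k.
exact: differentiable_uptoD.
Qed.

Lemma smooth_onM f g : smooth_on U f -> smooth_on U g -> smooth_on U (f * g).
Proof.
move=> /smooth_on_upto fU /smooth_on_upto gU; apply/smooth_on_upto => k.
exact: differentiable_uptoM.
Qed.

Lemma smooth_onV f : (forall x, U x -> f x != 0) -> smooth_on U f ->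
  smooth_on U (fun x => (f x)^-1).
Proof.
move=> f0 /smooth_on_upto fU; apply/smooth_on_upto => k.
exact: differentiable_uptoV.
Qed.

Lemma smooth_on_sum (I : Type) (r : seq I) (P : pred I)
    (F : I -> 'rV[R]_n -> R) :
  (forall j, P j -> smooth_on U (F j)) ->
  smooth_on U (fun x => \sum_(j <- r | P j) F j x).
Proof.
move=> FU; rewrite -(fct_sumE r P F).
by elim/big_ind: _; [exact: smooth_on_cst|exact: smooth_onD|].
Qed.

Lemma smooth_on_prod (I : Type) (r : seq I) (P : pred I)
    (F : I -> 'rV[R]_n -> R) :
  (forall j, P j -> smooth_on U (F j)) ->
  smooth_on U (fun x => \prod_(j <- r | P j) F j x).
Proof.
move=> FU; rewrite -(fct_prodE r P F).
by elim/big_ind: _; [exact: smooth_on_cst|exact: smooth_onM|].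
Qed.

Lemma smooth_on_det m (A : 'rV[R]_n -> 'M[R]_m) :
  (forall p q, smooth_on U (fun x => A x p q)) ->
  smooth_on U (fun x => \det (A x)).
Proof.
move=> AU; apply: smooth_on_sum => s _.
by apply: smooth_onM; [exact: smooth_on_cst|exact: smooth_on_prod].
Qed.

(** By Cramer's rule the entries of the inverse are cofactors divided by the
determinant. *)
Lemma smooth_on_invmx m (A : 'rV[R]_n -> 'M[R]_m) :
  (forall x, U x -> A x \in unitmx) ->
  (forall p q, smooth_on U (fun x => A x p q)) ->
  forall p q, smooth_on U (fun x => invmx (A x) p q).
Proof.
move=> Aunit AU p q.
have detU : smooth_on U (fun x => (\det (A x))^-1).
  apply: smooth_onV; last exact: smooth_on_det.
  by move=> x /Aunit; rewrite unitmxE unitfE.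
have cofU : smooth_on U (fun x => cofactor (A x) q p).
  apply: smooth_onM; first exact: smooth_on_cst.
  apply: smooth_on_det => p' q'.
  by rewrite (_ : (fun _ => _) = fun x => A x (lift q p') (lift p q'))//;
    apply/funext => x; rewrite !mxE.
apply: (smooth_on_eq _ (smooth_onM detU cofU)) => x; rewrite inE => Ux.
by rewrite /invmx Aunit// !mxE.
Qed.

End SmoothOn.

(** * Vector fields as derivations *)

Section VectorFieldTheory.
Context {R : realType} {n : nat} {M : manifold R n}.
Local Notation vf := ((M -> R) -> M -> R).
Implicit Types (f h : M -> R) (X Y Z : vf).

Lemma open_range_chart (c : chart R n M) : atlas M c -> open (range_chart c).
Proof. by move=> /atlas_chart[]. Qed.

Lemma manifold_chartP (p : M) :
  exists2 c, atlas M c & exists2 x, range_chart c x & param c x = p.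
Proof.
have [c Mc cp] := atlas_cover p; exists c => //; exists (Defs.coord c p).
  by exists p.
by have [_ _ ->] := atlas_chart Mc.
Qed.

Lemma smooth_cst (k : R) : smooth (cst k : M -> R).
Proof. by move=> c Mc; exact: (@smooth_on_cst _ _ _ k). Qed.

Lemma smooth1 : smooth (1 : M -> R).
Proof. exact: (smooth_cst 1). Qed.

Lemma smoothD f h : smooth f -> smooth h -> smooth (f + h).
Proof.
move=> fs hs c Mc.
exact: (smooth_onD (open_range_chart Mc) (fs c Mc) (hs c Mc)).
Qed.

Lemma smoothM f h : smooth f -> smooth h -> smooth (f * h).
Proof.
move=> fs hs c Mc.
exact: (smooth_onM (open_range_chart Mc) (fs c Mc) (hs c Mc)).
Qed.

Lemma smoothN f : smooth f -> smooth (- f).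
Proof. by move=> fs; rewrite -mulN1r; exact/smoothM/fs/(smooth_cst (-1)). Qed.

(** No smoothness of [f] is required: a vector field sends a non-smooth function
to 0. *)
Lemma vf_smooth X f : vector_field X -> smooth (X f).
Proof.
move=> [X0 Xc]; have [fs|/X0->] := pselect (smooth f); last first.
  exact: (smooth_cst 0).
move=> c Mc; have [a [aS Xa]] := Xc c Mc; have cU := open_range_chart Mc.
apply: (@smooth_on_eq _ _ _ cU
    (fun x => \sum_(i < n) (a i * partial i (f \o param c)) x)) => [x|].
  by rewrite inE => cx; rewrite /= Xa.
apply: smooth_on_sum => // i _; apply: smooth_onM => //.
exact/smooth_on_partial/fs.
Qed.

Lemma vf_fctD X f h : vector_field X -> smooth f -> smooth h ->
  X (f + h) = X f + X h.
Proof.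
move=> [_ Xc] fs hs; apply/funext => p.
have [c Mc [x cx <-]] := manifold_chartP p; have [a [aS Xa]] := Xc c Mc.
change (X (f + h) (param c x) = X f (param c x) + X h (param c x)).
rewrite !Xa//; last exact: smoothD.
rewrite -big_split/=; apply: eq_bigr => i _.
rewrite -mulrDr -partialD//; first exact: smooth_on_differentiable (fs c Mc) cx.
exact: smooth_on_differentiable (hs c Mc) cx.
Qed.

Lemma vf_fctM X f h : vector_field X -> smooth f -> smooth h ->
  X (f * h) = f * X h + h * X f.
Proof.
move=> [_ Xc] fs hs; apply/funext => p.
have [c Mc [x cx <-]] := manifold_chartP p; have [a [aS Xa]] := Xc c Mc.
change (X (f * h) (param c x) =
  f (param c x) * X h (param c x) + h (param c x) * X f (param c x)).
rewrite !Xa//; last exact: smoothM.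
rewrite !mulr_sumr -big_split/=; apply: eq_bigr => i _.
rewrite [LHS](_ : _ = a i x * partial i ((f \o param c) * (h \o param c)) x)//.
rewrite partialM; first by rewrite /=; ring.
- exact: smooth_on_differentiable (fs c Mc) cx.
- exact: smooth_on_differentiable (hs c Mc) cx.
Qed.

Lemma vf_fct_cst X (k : R) : vector_field X -> X (cst k) = 0.
Proof.
move=> [_ Xc]; apply/funext => p.
have [c Mc [x cx <-]] := manifold_chartP p; have [a [aS Xa]] := Xc c Mc.
rewrite Xa//; last exact: smooth_cst.
by rewrite big1// => i _; rewrite (partial_cst i k) mulr0.
Qed.

Lemma vector_field0 : vector_field (0 : vf).
Proof.
split=> // c Mc; exists (fun _ => cst 0); split=> [i|f x fs cx].
  exact: smooth_on_cst.
by rewrite big1// => i _; rewrite mul0r.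
Qed.

Lemma vector_fieldD X Y : vector_field X -> vector_field Y ->
  vector_field (X + Y).
Proof.
move=> [X0 Xc] [Y0 Yc]; split=> [f fs|c Mc].
  by rewrite fctE X0// Y0// addr0.
have [a [aS Xa]] := Xc c Mc; have [b [bS Yb]] := Yc c Mc.
exists (fun i => a i + b i); split=> [i|f x fs cx].
  by apply: smooth_onD => //; exact: open_range_chart.
change (X f (param c x) + Y f (param c x) =
  \sum_(i < n) (a i x + b i x) * partial i (f \o param c) x).
rewrite Xa// Yb// -big_split/=; apply: eq_bigr => i _.
by rewrite -mulrDl.
Qed.

Lemma vector_field_fscale f X : smooth f -> vector_field X ->
  vector_field (fscale f X).
Proof.
move=> fs [X0 Xc]; split=> [h hs|c Mc].
  by apply/funext => p; rewrite /fscale X0// mulr0.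
have [a [aS Xa]] := Xc c Mc.
exists (fun i => (f \o param c) * a i); split=> [i|h x hs cx].
  apply: smooth_onM => //; first exact: open_range_chart.
  exact: fs.
rewrite /fscale Xa// mulr_sumr; apply: eq_bigr => i _.
by rewrite mulrA.
Qed.

Lemma fscale_cst (k : R) X : fscale (cst k) X = k *: X.
Proof. by []. Qed.

Lemma fscale1 X : fscale 1 X = X.
Proof.
by apply/funext => f; apply/funext => p; rewrite /fscale mul1r.
Qed.

Lemma fscale0l X : fscale 0 X = 0.
Proof.
by apply/funext => h; apply/funext => p; rewrite /fscale mul0r.
Qed.

Lemma vector_fieldZ (k : R) X : vector_field X -> vector_field (k *: X).
Proof. by move=> vX; apply: vector_field_fscale => //; exact: smooth_cst. Qed.

Lemma vector_fieldN X : vector_field X -> vector_field (- X).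
Proof. by move=> vX; rewrite -scaleN1r; exact: vector_fieldZ. Qed.

Lemma vector_fieldB X Y : vector_field X -> vector_field Y ->
  vector_field (X - Y).
Proof. by move=> vX vY; apply: vector_fieldD => //; exact: vector_fieldN. Qed.

Lemma fscaleN f X : fscale f (- X) = - fscale f X.
Proof.
by apply/funext => h; apply/funext => p; rewrite /fscale !fctE mulrN.
Qed.

Lemma lie_bracketC X Y : lie_bracket X Y = - lie_bracket Y X.
Proof. by apply/funext => f; rewrite /lie_bracket fctE opprB. Qed.

Lemma lie_bracketDr X Y Z : vector_field X -> vector_field Y ->
  vector_field Z -> lie_bracket X (Y + Z) = lie_bracket X Y + lie_bracket X Z.
Proof.
move=> vX vY vZ; apply/funext => f; rewrite /lie_bracket !fctE.
rewrite vf_fctD//; try exact: vf_smooth.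
by apply/funext => p; rewrite !fctE; ring.
Qed.

Lemma lie_bracketDl X Y Z : vector_field X -> vector_field Y ->
  vector_field Z -> lie_bracket (X + Y) Z = lie_bracket X Z + lie_bracket Y Z.
Proof.
move=> vX vY vZ; rewrite lie_bracketC lie_bracketDr// opprD.
by rewrite -!lie_bracketC.
Qed.

(** The Leibniz rule for the bracket also holds at non-smooth arguments, where
both sides vanish. *)
Lemma lie_bracket_fscaler f X Y : smooth f -> vector_field X ->
  vector_field Y ->
  lie_bracket X (fscale f Y) = fscale f (lie_bracket X Y) + fscale (X f) Y.
Proof.
move=> fs vX vY; apply/funext => h.
rewrite [LHS](_ : _ = X (f * Y h) - f * Y (X h))//.
rewrite vf_fctM//; last exact: vf_smooth.
apply/funext => p; rewrite /fscale/lie_bracket !fctE; ring.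
Qed.

Lemma lie_bracket_fscalel f X Y : smooth f -> vector_field X ->
  vector_field Y ->
  lie_bracket (fscale f X) Y = fscale f (lie_bracket X Y) - fscale (Y f) X.
Proof.
move=> fs vX vY; rewrite lie_bracketC lie_bracket_fscaler// opprD.
by rewrite (lie_bracketC X Y) fscaleN.
Qed.

Lemma lie_bracketZr (k : R) X Y : vector_field X -> vector_field Y ->
  lie_bracket X (k *: Y) = k *: lie_bracket X Y.
Proof.
move=> vX vY; rewrite -fscale_cst lie_bracket_fscaler ?vf_fct_cst//.
  by apply/funext => h; apply/funext => p; rewrite /fscale !fctE mul0r addr0.
exact: smooth_cst.
Qed.

Lemma lie_bracketZl (k : R) X Y : vector_field X -> vector_field Y ->
  lie_bracket (k *: X) Y = k *: lie_bracket X Y.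
Proof.
move=> vX vY; rewrite lie_bracketC lie_bracketZr// -scalerN.
by rewrite -lie_bracketC.
Qed.

End VectorFieldTheory.

(** * Global frames *)

Section Frames.
Context {R : realType} {n : nat} {M : manifold R n}.
Local Notation vf := ((M -> R) -> M -> R).
Implicit Types (e : 'I_n -> vf) (X Y Z : vf).

Definition pointwise_independent e : Prop :=
  forall (p : M) (v : 'rV[R]_n),
    (forall f, smooth f -> \sum_(i < n) v 0 i * e i f p = 0) -> v = 0.

Lemma sum_row_mulmx (v : 'rV[R]_n) (A : 'M[R]_n) (d : 'I_n -> R) :
  \sum_(i < n) v 0 i * (\sum_(j < n) A i j * d j) =
  \sum_(j < n) (v *m A) 0 j * d j.
Proof.
under eq_bigr do rewrite mulr_sumr.
rewrite exchange_big/=; apply: eq_bigr => j _.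
by rewrite mxE mulr_suml; apply: eq_bigr => i _; rewrite mulrA.
Qed.

(** In a chart, independence makes the matrix of components of the frame
invertible, and the components of [Z] in the frame are its components in the
chart multiplied by the inverse matrix. *)
Lemma frame_local_expansion e Z (c : chart R n M) : atlas M c ->
  (forall i, vector_field (e i)) -> pointwise_independent e ->
  vector_field Z ->
  exists w : 'rV[R]_n -> 'rV[R]_n,
    (forall i, smooth_on (range_chart c) (fun x => w x 0 i)) /\
    forall f x, smooth f -> range_chart c x ->
      Z f (param c x) = \sum_(i < n) w x 0 i * e i f (param c x).
Proof.
move=> Mc ve eI [_ /(_ c Mc)[b [bS Zb]]].
have cU := open_range_chart Mc.
have /choice[a aE] i := (ve i).2 c Mc.
pose A x : 'M[R]_n := \matrix_(i, j) a i j x.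
have eA i f x : smooth f -> range_chart c x ->
    e i f (param c x) = \sum_(j < n) A x i j * partial j (f \o param c) x.
  move=> fs cx; have [_ ->//] := aE i.
  by apply: eq_bigr => j _; rewrite mxE.
have Aunit x : range_chart c x -> A x \in unitmx.
  move=> cx; rewrite -row_free_unit -kermx_eq0; apply/rowV0P => v.
  move=> /sub_kermxP vA; apply: (eI (param c x)) => f fs.
  under eq_bigr do rewrite eA//.
  by rewrite sum_row_mulmx vA big1// => j _; rewrite mxE mul0r.
pose w x := (\row_j b j x) *m invmx (A x).
exists w; split=> [i|f x fs cx].
  apply: (@smooth_on_eq _ _ _ cU
    (fun x => \sum_(j < n) (b j * (fun x => invmx (A x) j i)) x)) => [x _|].
    by rewrite mxE; apply: eq_bigr => j _; rewrite !mxE.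
  apply: smooth_on_sum => // j _; apply: smooth_onM => //.
  apply: smooth_on_invmx => // p q.
  apply: (@smooth_on_eq _ _ _ cU (a p q)) => [x _|]; first by rewrite mxE.
  by have [] := aE p.
under [RHS]eq_bigr do rewrite eA//.
rewrite sum_row_mulmx mulmxKV ?Aunit// Zb//.
by apply: eq_bigr => j _; rewrite mxE.
Qed.

Lemma frame_expansion e Z :
  (forall i, vector_field (e i)) -> pointwise_independent e ->
  vector_field Z ->
  exists z : 'I_n -> M -> R,
    (forall i, smooth (z i)) /\ Z = \sum_(i < n) fscale (z i) (e i).
Proof.
move=> ve eI vZ.
have /choice[v vE] (p : M) : exists v : 'rV[R]_n, forall f, smooth f ->
    Z f p = \sum_(i < n) v 0 i * e i f p.
  have [c Mc [x cx <-]] := manifold_chartP p.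
  have [w [_ wE]] := frame_local_expansion Mc ve eI vZ.
  by exists (w x) => f fs; exact: wE.
exists (fun i p => v p 0 i); split=> [i c Mc|].
  have [w [wS wE]] := frame_local_expansion Mc ve eI vZ.
  apply: (@smooth_on_eq _ _ _ (open_range_chart Mc) _ _ _ (wS i)) => x.
  rewrite inE => cx /=; suff -> : w x = v (param c x) by [].
  (* independence makes the components at a point unique, hence independent of
     the chart used to compute them *)
  apply/subr0_eq/(eI (param c x)) => f fs.
  under eq_bigr do rewrite !mxE mulrBl.
  by rewrite sumrB -wE// -vE// subrr.
apply/funext => f; apply/funext => p; rewrite !fct_sumE.
have [fs|fs] := pselect (smooth f); first by rewrite vE.
rewrite vZ.1// big1// => i _.
by rewrite /fscale (ve i).1// mulr0.
Qed.

(** The principle by which tensorial identities only have to be checked on a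
frame. *)
Lemma frame_ind e (P : vf -> Prop) :
  (forall i, vector_field (e i)) -> pointwise_independent e ->
  (forall X Y, vector_field X -> vector_field Y -> P X -> P Y -> P (X + Y)) ->
  (forall f X, smooth f -> vector_field X -> P X -> P (fscale f X)) ->
  P 0 -> (forall i, P (e i)) -> forall X, vector_field X -> P X.
Proof.
move=> ve eI PD PZ P0 Pe X vX; have [z [zs ->]] := frame_expansion ve eI vX.
suff [] : vector_field (\sum_(i < n) fscale (z i) (e i)) /\
    P (\sum_(i < n) fscale (z i) (e i)) by [].
elim/big_ind: _ => [|Y Y' [vY PY] [vY' PY']|i _].
- by split=> //; exact: vector_field0.
- by split; [exact: vector_fieldD|exact: PD].
- by split; [exact: vector_field_fscale|exact: PZ].
Qed.

(** Going through a frame avoids the symmetry of second derivatives: the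
second-order terms of the bracket never appear. *)
Lemma vector_field_bracket e :
  (forall i, vector_field (e i)) -> pointwise_independent e ->
  (forall i j, vector_field (lie_bracket (e i) (e j))) ->
  forall X Y, vector_field X -> vector_field Y ->
    vector_field (lie_bracket X Y).
Proof.
move=> ve eI bre X Y vX vY; move: X vX.
have br0 (Z : vf) : vector_field Z -> vector_field (lie_bracket Z 0).
  move=> vZ; rewrite -(scale0r (0 : vf)) lie_bracketZr//.
    by rewrite scale0r; exact: vector_field0.
  exact: vector_field0.
apply: (frame_ind ve eI) => [X X' vX vX'|f X fs vX| |i].
- by rewrite lie_bracketDl//; exact: vector_fieldD.
- move=> vXY; rewrite lie_bracket_fscalel//; apply: vector_fieldB.
    exact: vector_field_fscale.
  by apply: vector_field_fscale => //; exact: vf_smooth.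
- by rewrite lie_bracketC; apply: vector_fieldN; exact: br0.
move: Y vY; apply: (frame_ind ve eI) => [Y Y' vY vY'|f Y fs vY| |j].
- by rewrite lie_bracketDr//; exact: vector_fieldD.
- move=> vXY; rewrite lie_bracket_fscaler//; apply: vector_fieldD.
    exact: vector_field_fscale.
  by apply: vector_field_fscale => //; exact: vf_smooth.
- exact: br0.
- exact: bre.
Qed.

End Frames.

(** * Tensoriality *)

Section Tensors.
Context {R : realType} {n : nat} {M : manifold R n}.
Local Notation vf := ((M -> R) -> M -> R).
Context (w : vf -> vf -> M -> R) (w_tensor : tensor02 w).
Implicit Types (f : M -> R) (X Y Z : vf).

Lemma tensor_smooth X Y : vector_field X -> vector_field Y -> smooth (w X Y).
Proof. by case: w_tensor => + _ _; apply. Qed.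

Let tensor_linl f X X' Y : smooth f -> vector_field X -> vector_field X' ->
  vector_field Y -> w (fscale f X + X') Y = f * w X Y + w X' Y.
Proof. by case: w_tensor => _ + _; apply. Qed.

Let tensor_linr f X Y Y' : smooth f -> vector_field X -> vector_field Y ->
  vector_field Y' -> w X (fscale f Y + Y') = f * w X Y + w X Y'.
Proof. by case: w_tensor => _ _; apply. Qed.

Lemma tensorDl X X' Y : vector_field X -> vector_field X' ->
  vector_field Y -> w (X + X') Y = w X Y + w X' Y.
Proof.
move=> vX vX' vY; have := tensor_linl smooth1 vX vX' vY.
by rewrite fscale1 mul1r.
Qed.

Lemma tensorDr X Y Y' : vector_field X -> vector_field Y ->
  vector_field Y' -> w X (Y + Y') = w X Y + w X Y'.
Proof.
move=> vX vY vY'; have := tensor_linr smooth1 vX vY vY'.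
by rewrite fscale1 mul1r.
Qed.

Lemma tensor0l Y : vector_field Y -> w 0 Y = 0.
Proof.
move=> vY; have v0 := @vector_field0 R n M.
by apply: (addrI (w 0 Y)); rewrite -tensorDl// !addr0.
Qed.

Lemma tensor0r X : vector_field X -> w X 0 = 0.
Proof.
move=> vX; have v0 := @vector_field0 R n M.
by apply: (addrI (w X 0)); rewrite -tensorDr// !addr0.
Qed.

Lemma tensor_fscalel f X Y : smooth f -> vector_field X ->
  vector_field Y -> w (fscale f X) Y = f * w X Y.
Proof.
move=> fs vX vY; have := tensor_linl fs vX (@vector_field0 R n M) vY.
by rewrite addr0 tensor0l// addr0.
Qed.

Lemma tensor_fscaler f X Y : smooth f -> vector_field X ->
  vector_field Y -> w X (fscale f Y) = f * w X Y.
Proof.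
move=> fs vX vY; have := tensor_linr fs vX vY (@vector_field0 R n M).
by rewrite addr0 tensor0r// addr0.
Qed.

Lemma tensorZl (k : R) X Y : vector_field X -> vector_field Y ->
  w (k *: X) Y = k *: w X Y.
Proof.
move=> vX vY; rewrite -[k *: X]/(fscale (cst k) X) tensor_fscalel//.
exact: smooth_cst.
Qed.

Lemma tensorZr (k : R) X Y : vector_field X -> vector_field Y ->
  w X (k *: Y) = k *: w X Y.
Proof.
move=> vX vY; rewrite -[k *: Y]/(fscale (cst k) Y) tensor_fscaler//.
exact: smooth_cst.
Qed.

Lemma tensorNl X Y : vector_field X -> vector_field Y -> w (- X) Y = - w X Y.
Proof. by move=> vX vY; rewrite -scaleN1r tensorZl// scaleN1r. Qed.

End Tensors.

Section TensorSpace.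
Context {R : realType} {n : nat} {M : manifold R n}.
Local Notation vf := ((M -> R) -> M -> R).
Implicit Types (w : vf -> vf -> M -> R) (X Y Z : vf).

Lemma tensor02I w :
  (forall X Y, vector_field X -> vector_field Y -> smooth (w X Y)) ->
  (forall X X' Y, vector_field X -> vector_field X' -> vector_field Y ->
     w (X + X') Y = w X Y + w X' Y) ->
  (forall X Y Y', vector_field X -> vector_field Y -> vector_field Y' ->
     w X (Y + Y') = w X Y + w X Y') ->
  (forall f X Y, smooth f -> vector_field X -> vector_field Y ->
     w (fscale f X) Y = f * w X Y) ->
  (forall f X Y, smooth f -> vector_field X -> vector_field Y ->
     w X (fscale f Y) = f * w X Y) ->
  tensor02 w.
Proof.
move=> ws wDl wDr wZl wZr.
split=> // [f X X' Y fs vX vX' vY|f X Y Y' fs vX vY vY'].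
  by rewrite wDl ?wZl//; exact: vector_field_fscale.
by rewrite wDr ?wZr//; exact: vector_field_fscale.
Qed.

Lemma tensor02_flip w : tensor02 w -> tensor02 (fun X Y => w Y X).
Proof. by move=> [ws wl wr]; split=> *; [exact: ws|exact: wr|exact: wl]. Qed.

Lemma tensor02D w w' : tensor02 w -> tensor02 w' ->
  tensor02 (fun X Y => w X Y + w' X Y).
Proof.
move=> wt wt'; apply: tensor02I => *.
- by apply: smoothD; exact: tensor_smooth.
- by rewrite (tensorDl wt)// (tensorDl wt')// addrACA.
- by rewrite (tensorDr wt)// (tensorDr wt')// addrACA.
- by rewrite (tensor_fscalel wt)// (tensor_fscalel wt')// mulrDr.
- by rewrite (tensor_fscaler wt)// (tensor_fscaler wt')// mulrDr.
Qed.

Lemma tensor02Z (k : R) w : tensor02 w -> tensor02 (fun X Y => k *: w X Y).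
Proof.
move=> wt; have kE (f : M -> R) : k *: f = cst k * f by [].
apply: tensor02I => *; rewrite ?kE.
- by apply: smoothM; [exact: smooth_cst|exact: tensor_smooth].
- by rewrite (tensorDl wt)// mulrDr.
- by rewrite (tensorDr wt)// mulrDr.
- by rewrite (tensor_fscalel wt)// mulrCA.
- by rewrite (tensor_fscaler wt)// mulrCA.
Qed.

End TensorSpace.

Section Connections.
Context {R : realType} {n : nat} {M : manifold R n}.
Local Notation vf := ((M -> R) -> M -> R).
Context (nabla : vf -> vf -> vf) (nabla_conn : linear_connection nabla).
Implicit Types (f : M -> R) (X Y Z : vf).

Lemma vector_field_conn X Y : vector_field X -> vector_field Y ->
  vector_field (nabla X Y).
Proof. by case: nabla_conn => + _ _ _; apply. Qed.

Let conn_linl f X X' Y : smooth f -> vector_field X -> vector_field X' ->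
  vector_field Y ->
  nabla (fscale f X + X') Y = fscale f (nabla X Y) + nabla X' Y.
Proof. by case: nabla_conn => _ + _ _; apply. Qed.

Lemma connDr X Y Y' : vector_field X -> vector_field Y -> vector_field Y' ->
  nabla X (Y + Y') = nabla X Y + nabla X Y'.
Proof. by case: nabla_conn => _ _ + _; apply. Qed.

Lemma conn_fscaler f X Y : smooth f -> vector_field X -> vector_field Y ->
  nabla X (fscale f Y) = fscale f (nabla X Y) + fscale (X f) Y.
Proof. by move=> *; rewrite addrC; case: nabla_conn => _ _ _; apply. Qed.

Lemma connDl X X' Y : vector_field X -> vector_field X' ->
  vector_field Y -> nabla (X + X') Y = nabla X Y + nabla X' Y.
Proof.
move=> vX vX' vY; have := conn_linl smooth1 vX vX' vY.
by rewrite !fscale1.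
Qed.

Lemma conn0l Y : vector_field Y -> nabla 0 Y = 0.
Proof.
move=> vY; have v0 := @vector_field0 R n M.
by apply: (addrI (nabla 0 Y)); rewrite -connDl// !addr0.
Qed.

Lemma conn_fscalel f X Y : smooth f -> vector_field X ->
  vector_field Y -> nabla (fscale f X) Y = fscale f (nabla X Y).
Proof.
move=> fs vX vY; have := conn_linl fs vX (@vector_field0 R n M) vY.
by rewrite addr0 conn0l// addr0.
Qed.

Lemma connZl (k : R) X Y : vector_field X -> vector_field Y ->
  nabla (k *: X) Y = k *: nabla X Y.
Proof.
move=> vX vY; rewrite -[k *: X]/(fscale (cst k) X) conn_fscalel//.
exact: smooth_cst.
Qed.

Lemma connZr (k : R) X Y : vector_field X -> vector_field Y ->
  nabla X (k *: Y) = k *: nabla X Y.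
Proof.
move=> vX vY; have ks := @smooth_cst _ _ M k.
rewrite -[k *: Y]/(fscale (cst k) Y) conn_fscaler//.
by rewrite vf_fct_cst// fscale0l addr0.
Qed.

Lemma connNl X Y : vector_field X -> vector_field Y ->
  nabla (- X) Y = - nabla X Y.
Proof. by move=> vX vY; rewrite -scaleN1r connZl// scaleN1r. Qed.

Lemma torsionC X Y : torsion nabla X Y = - torsion nabla Y X.
Proof.
rewrite /torsion (lie_bracketC X Y).
apply/funext => h; apply/funext => p; rewrite !fctE; ring.
Qed.

Lemma torsionDl X X' Y : vector_field X -> vector_field X' ->
  vector_field Y ->
  torsion nabla (X + X') Y = torsion nabla X Y + torsion nabla X' Y.
Proof.
move=> vX vX' vY; rewrite /torsion connDl// connDr// lie_bracketDl//.
apply/funext => h; apply/funext => p; rewrite !fctE; ring.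
Qed.

(** The derivative of [f] comes once from the connection and once from the
bracket, with opposite signs. *)
Lemma torsion_fscalel f X Y : smooth f -> vector_field X ->
  vector_field Y -> torsion nabla (fscale f X) Y = fscale f (torsion nabla X Y).
Proof.
move=> fs vX vY; rewrite /torsion conn_fscalel// conn_fscaler//.
rewrite lie_bracket_fscalel//.
apply/funext => h; apply/funext => p; rewrite /fscale !fctE; ring.
Qed.

Context (bracket_closed : forall X Y, vector_field X -> vector_field Y ->
  vector_field (lie_bracket X Y)).

Lemma vector_field_torsion X Y : vector_field X -> vector_field Y ->
  vector_field (torsion nabla X Y).
Proof.
move=> vX vY; apply: vector_fieldB; last exact: bracket_closed.
by apply: vector_fieldB; exact: vector_field_conn.
Qed.

Lemma vector_field_curvature X Y Z : vector_field X -> vector_field Y ->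
  vector_field Z -> vector_field (curvature nabla X Y Z).
Proof.
move=> vX vY vZ; have vXY := bracket_closed vX vY.
by apply: vector_fieldB; [apply: vector_fieldB|];
  repeat apply: vector_field_conn.
Qed.

Lemma curvatureDl X X' Y Z : vector_field X -> vector_field X' ->
  vector_field Y -> vector_field Z ->
  curvature nabla (X + X') Y Z = curvature nabla X Y Z + curvature nabla X' Y Z.
Proof.
move=> vX vX' vY vZ; rewrite /curvature.
have vc := vector_field_conn.
rewrite lie_bracketDl//.
rewrite (connDl (bracket_closed vX vY) (bracket_closed vX' vY))//.
rewrite (connDl vX vX' (vc _ _ vY vZ)) (connDl vX vX' vZ).
rewrite (connDr vY (vc _ _ vX vZ) (vc _ _ vX' vZ)).
apply/funext => h; apply/funext => p; rewrite !fctE; ring.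
Qed.

Lemma curvatureDr X Y Z Z' : vector_field X -> vector_field Y ->
  vector_field Z -> vector_field Z' ->
  curvature nabla X Y (Z + Z') = curvature nabla X Y Z + curvature nabla X Y Z'.
Proof.
move=> vX vY vZ vZ'; have vXY := bracket_closed vX vY.
have vc := vector_field_conn.
rewrite /curvature !(connDr _ vZ vZ')//.
rewrite (connDr vX (vc _ _ vY vZ) (vc _ _ vY vZ')).
rewrite (connDr vY (vc _ _ vX vZ) (vc _ _ vX vZ')).
apply/funext => h; apply/funext => p; rewrite !fctE; ring.
Qed.

Lemma curvature_fscalel f X Y Z : smooth f -> vector_field X ->
  vector_field Y -> vector_field Z ->
  curvature nabla (fscale f X) Y Z = fscale f (curvature nabla X Y Z).
Proof.
move=> fs vX vY vZ; have vXY := bracket_closed vX vY.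
have vXZ := vector_field_conn vX vZ; have vYZ := vector_field_conn vY vZ.
have Yfs := vf_smooth f vY.
have vYfX := vector_field_fscale Yfs vX.
rewrite /curvature lie_bracket_fscalel// connDl ?connNl//; first last.
- exact: vector_fieldN.
- exact: vector_field_fscale.
rewrite !conn_fscalel// conn_fscaler//.
apply/funext => h; apply/funext => p; rewrite /fscale !fctE; ring.
Qed.

(** The derivatives of the factor [f] cancel: the second-order ones because
the third term of the curvature subtracts the derivative along the bracket. *)
Lemma curvature_fscaler f X Y Z : smooth f -> vector_field X ->
  vector_field Y -> vector_field Z ->
  curvature nabla X Y (fscale f Z) = fscale f (curvature nabla X Y Z).
Proof.
move=> fs vX vY vZ; have vXY := bracket_closed vX vY.
have vXZ := vector_field_conn vX vZ; have vYZ := vector_field_conn vY vZ.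
have Xfs := vf_smooth f vX; have Yfs := vf_smooth f vY.
rewrite /curvature !conn_fscaler// !connDr//;
  try exact: vector_field_fscale.
rewrite !conn_fscaler//.
apply/funext => h; apply/funext => p.
rewrite /fscale /lie_bracket !fctE; ring.
Qed.

Context (w : vf -> vf -> M -> R) (w_tensor : tensor02 w).

Lemma cov_derivDl X X' Y Z : vector_field X -> vector_field X' ->
  vector_field Y -> vector_field Z ->
  cov_deriv nabla w (X + X') Y Z =
  cov_deriv nabla w X Y Z + cov_deriv nabla w X' Y Z.
Proof.
move=> vX vX' vY vZ; have vc := vector_field_conn; rewrite /cov_deriv.
rewrite (connDl vX vX' vY) (connDl vX vX' vZ).
rewrite (tensorDl w_tensor (vc _ _ vX vY) (vc _ _ vX' vY) vZ).
rewrite (tensorDr w_tensor vY (vc _ _ vX vZ) (vc _ _ vX' vZ)).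
apply/funext => p; rewrite !fctE; ring.
Qed.

Lemma cov_deriv_fscalel f X Y Z : smooth f -> vector_field X ->
  vector_field Y -> vector_field Z ->
  cov_deriv nabla w (fscale f X) Y Z = f * cov_deriv nabla w X Y Z.
Proof.
move=> fs vX vY vZ; have vc := vector_field_conn; rewrite /cov_deriv.
rewrite (conn_fscalel fs vX vY) (conn_fscalel fs vX vZ).
rewrite (tensor_fscalel w_tensor fs (vc _ _ vX vY) vZ).
rewrite (tensor_fscaler w_tensor fs vY (vc _ _ vX vZ)).
apply/funext => p; rewrite /fscale !fctE; ring.
Qed.

Lemma cov_derivDm X Y Y' Z : vector_field X -> vector_field Y ->
  vector_field Y' -> vector_field Z ->
  cov_deriv nabla w X (Y + Y') Z =
  cov_deriv nabla w X Y Z + cov_deriv nabla w X Y' Z.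
Proof.
move=> vX vY vY' vZ; have vc := vector_field_conn; rewrite /cov_deriv.
have ws := tensor_smooth w_tensor.
rewrite (connDr vX vY vY') (tensorDl w_tensor vY vY' vZ).
rewrite (tensorDl w_tensor (vc _ _ vX vY) (vc _ _ vX vY') vZ).
rewrite (tensorDl w_tensor vY vY' (vc _ _ vX vZ)).
rewrite (vf_fctD vX (ws _ _ vY vZ) (ws _ _ vY' vZ)).
apply/funext => p; rewrite !fctE; ring.
Qed.

Lemma cov_deriv_fscalem f X Y Z : smooth f -> vector_field X ->
  vector_field Y -> vector_field Z ->
  cov_deriv nabla w X (fscale f Y) Z = f * cov_deriv nabla w X Y Z.
Proof.
move=> fs vX vY vZ; have vc := vector_field_conn; rewrite /cov_deriv.
have ws := tensor_smooth w_tensor; have Xfs := vf_smooth f vX.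
have vfc := vector_field_fscale fs (vc _ _ vX vY).
rewrite (conn_fscaler fs vX vY).
rewrite (tensorDl w_tensor vfc (vector_field_fscale Xfs vY) vZ).
rewrite (tensor_fscalel w_tensor fs vY vZ).
rewrite (tensor_fscalel w_tensor fs (vc _ _ vX vY) vZ).
rewrite (tensor_fscalel w_tensor Xfs vY vZ).
rewrite (tensor_fscalel w_tensor fs vY (vc _ _ vX vZ)).
rewrite (vf_fctM vX fs (ws _ _ vY vZ)).
apply/funext => p; rewrite !fctE; ring.
Qed.

Lemma cov_derivDr X Y Z Z' : vector_field X -> vector_field Y ->
  vector_field Z -> vector_field Z' ->
  cov_deriv nabla w X Y (Z + Z') =
  cov_deriv nabla w X Y Z + cov_deriv nabla w X Y Z'.
Proof.
move=> vX vY vZ vZ'; have vc := vector_field_conn; rewrite /cov_deriv.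
have ws := tensor_smooth w_tensor.
rewrite (connDr vX vZ vZ') (tensorDr w_tensor vY vZ vZ').
rewrite (tensorDr w_tensor (vc _ _ vX vY) vZ vZ').
rewrite (tensorDr w_tensor vY (vc _ _ vX vZ) (vc _ _ vX vZ')).
rewrite (vf_fctD vX (ws _ _ vY vZ) (ws _ _ vY vZ')).
apply/funext => p; rewrite !fctE; ring.
Qed.

Lemma cov_deriv_fscaler f X Y Z : smooth f -> vector_field X ->
  vector_field Y -> vector_field Z ->
  cov_deriv nabla w X Y (fscale f Z) = f * cov_deriv nabla w X Y Z.
Proof.
move=> fs vX vY vZ; have vc := vector_field_conn; rewrite /cov_deriv.
have ws := tensor_smooth w_tensor; have Xfs := vf_smooth f vX.
have vfc := vector_field_fscale fs (vc _ _ vX vZ).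
rewrite (conn_fscaler fs vX vZ).
rewrite (tensorDr w_tensor vY vfc (vector_field_fscale Xfs vZ)).
rewrite (tensor_fscaler w_tensor fs vY vZ).
rewrite (tensor_fscaler w_tensor fs vY (vc _ _ vX vZ)).
rewrite (tensor_fscaler w_tensor Xfs vY vZ).
rewrite (tensor_fscaler w_tensor fs (vc _ _ vX vY) vZ).
rewrite (vf_fctM vX fs (ws _ _ vY vZ)).
apply/funext => p; rewrite !fctE; ring.
Qed.

End Connections.

Section RicciTensor.
Context {R : realType} {n : nat} {M : manifold R n}.
Local Notation vf := ((M -> R) -> M -> R).
Context (nabla : vf -> vf -> vf) (nabla_conn : linear_connection nabla).
Context (bracket_closed : forall X Y : vf, vector_field X -> vector_field Y ->
  vector_field (lie_bracket X Y)).

Lemma tensor02_curvature (g : vf -> vf -> M -> R) (e : vf) :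
  tensor02 g -> vector_field e ->
  tensor02 (fun X Y => g (curvature nabla X e Y) e).
Proof.
move=> gt ve; have vR := vector_field_curvature nabla_conn bracket_closed.
apply: tensor02I => [X Y vX vY|X X' Y vX vX' vY|X Y Y' vX vY vY'
  |f X Y fs vX vY|f X Y fs vX vY].
- exact: tensor_smooth gt _ _ (vR _ _ _ vX ve vY) ve.
- rewrite (curvatureDl nabla_conn bracket_closed vX vX' ve vY).
  exact: tensorDl gt _ _ _ (vR _ _ _ vX ve vY) (vR _ _ _ vX' ve vY) ve.
- rewrite (curvatureDr nabla_conn bracket_closed vX ve vY vY').
  exact: tensorDl gt _ _ _ (vR _ _ _ vX ve vY) (vR _ _ _ vX ve vY') ve.
- rewrite (curvature_fscalel nabla_conn bracket_closed fs vX ve vY).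
  exact: tensor_fscalel gt _ _ _ fs (vR _ _ _ vX ve vY) ve.
- rewrite (curvature_fscaler nabla_conn bracket_closed fs vX ve vY).
  exact: tensor_fscalel gt _ _ _ fs (vR _ _ _ vX ve vY) ve.
Qed.

Lemma tensor02_sym_ricci (g : vf -> vf -> M -> R) (e1 e2 e3 : vf) :
  tensor02 g -> vector_field e1 -> vector_field e2 -> vector_field e3 ->
  tensor02 (sym_ricci g e1 e2 e3 nabla).
Proof.
move=> gt v1 v2 v3.
have rt : tensor02 (ricci g e1 e2 e3 nabla).
  rewrite (_ : ricci g e1 e2 e3 nabla = fun X Y =>
    (-1) *: g (curvature nabla X e1 Y) e1 +
    (-1) *: g (curvature nabla X e2 Y) e2 + g (curvature nabla X e3 Y) e3).
    by apply: tensor02D; [apply: tensor02D; apply: tensor02Z|];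
      exact: tensor02_curvature.
  by apply/funext => X; apply/funext => Y; rewrite !scaleN1r.
by apply: tensor02Z; apply: tensor02D => //; exact: tensor02_flip.
Qed.

(** The left-hand side of the quasi-statistical equation is antisymmetric in its
first two arguments, so linearity over smooth functions in the first and the
third one is enough. *)
Lemma quasi_statistical_frame (e : 'I_n -> vf) (w : vf -> vf -> M -> R) :
  (forall i, vector_field (e i)) -> pointwise_independent e -> tensor02 w ->
  (forall i j k, cov_deriv nabla w (e i) (e j) (e k)
     - cov_deriv nabla w (e j) (e i) (e k)
     + w (torsion nabla (e i) (e j)) (e k) = 0) ->
  quasi_statistical nabla w.
Proof.
move=> ve eI wt Qe.
pose Q X Y Z := cov_deriv nabla w X Y Z - cov_deriv nabla w Y X Z
  + w (torsion nabla X Y) Z.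
have vT := vector_field_torsion nabla_conn bracket_closed.
have v0 := @vector_field0 R n M.
have QC X Y Z : vector_field X -> vector_field Y -> vector_field Z ->
    Q X Y Z = - Q Y X Z.
  move=> vX vY vZ; rewrite /Q (torsionC nabla X).
  rewrite (tensorNl wt (vT _ _ vY vX) vZ).
  apply/funext => p; rewrite !fctE; ring.
have QDl X X' Y Z : vector_field X -> vector_field X' -> vector_field Y ->
    vector_field Z -> Q (X + X') Y Z = Q X Y Z + Q X' Y Z.
  move=> vX vX' vY vZ; rewrite /Q.
  rewrite (cov_derivDl nabla_conn wt vX vX' vY vZ).
  rewrite (cov_derivDm nabla_conn wt vY vX vX' vZ).
  rewrite (torsionDl nabla_conn vX vX' vY).
  rewrite (tensorDl wt (vT _ _ vX vY) (vT _ _ vX' vY) vZ).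
  apply/funext => p; rewrite !fctE; ring.
have QZl f X Y Z : smooth f -> vector_field X -> vector_field Y ->
    vector_field Z -> Q (fscale f X) Y Z = f * Q X Y Z.
  move=> fs vX vY vZ; rewrite /Q.
  rewrite (cov_deriv_fscalel nabla_conn wt fs vX vY vZ).
  rewrite (cov_deriv_fscalem nabla_conn wt fs vY vX vZ).
  rewrite (torsion_fscalel nabla_conn fs vX vY).
  rewrite (tensor_fscalel wt fs (vT _ _ vX vY) vZ).
  apply/funext => p; rewrite !fctE; ring.
have QDr X Y Z Z' : vector_field X -> vector_field Y -> vector_field Z ->
    vector_field Z' -> Q X Y (Z + Z') = Q X Y Z + Q X Y Z'.
  move=> vX vY vZ vZ'; rewrite /Q.
  rewrite (cov_derivDr nabla_conn wt vX vY vZ vZ').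
  rewrite (cov_derivDr nabla_conn wt vY vX vZ vZ').
  rewrite (tensorDr wt (vT _ _ vX vY) vZ vZ').
  apply/funext => p; rewrite !fctE; ring.
have QZr f X Y Z : smooth f -> vector_field X -> vector_field Y ->
    vector_field Z -> Q X Y (fscale f Z) = f * Q X Y Z.
  move=> fs vX vY vZ; rewrite /Q.
  rewrite (cov_deriv_fscaler nabla_conn wt fs vX vY vZ).
  rewrite (cov_deriv_fscaler nabla_conn wt fs vY vX vZ).
  rewrite (tensor_fscaler wt fs (vT _ _ vX vY) vZ).
  apply/funext => p; rewrite !fctE; ring.
have Q0l Y Z : vector_field Y -> vector_field Z -> Q 0 Y Z = 0.
  move=> vY vZ; apply: (addrI (Q 0 Y Z)).
  by rewrite -(QDl _ _ _ _ v0 v0 vY vZ) !addr0.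
have Q0r X Y : vector_field X -> vector_field Y -> Q X Y 0 = 0.
  move=> vX vY; apply: (addrI (Q X Y 0)).
  by rewrite -(QDr _ _ _ _ vX vY v0 v0) !addr0.
have reduce_l Y Z : vector_field Y -> vector_field Z ->
    (forall i, Q (e i) Y Z = 0) -> forall X, vector_field X -> Q X Y Z = 0.
  move=> vY vZ Qi; apply: (frame_ind ve eI) => //.
  - move=> X X' vX vX' QX QX'.
    by rewrite (QDl _ _ _ _ vX vX' vY vZ) QX QX' addr0.
  - by move=> f X fs vX QX; rewrite (QZl _ _ _ _ fs vX vY vZ) QX mulr0.
  - exact: Q0l.
move=> X Y Z vX vY vZ; change (Q X Y Z = 0); move: Z vZ.
apply: (frame_ind ve eI) => [Z Z' vZ vZ' QZ QZ'|f Z fs vZ QZ||k].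
- by rewrite (QDr _ _ _ _ vX vY vZ vZ') QZ QZ' addr0.
- by rewrite (QZr _ _ _ _ fs vX vY vZ) QZ mulr0.
- exact: Q0r.
have vk := ve k.
apply: (reduce_l _ _ vY vk) => // i; rewrite (QC _ _ _ (ve i) vY vk).
rewrite (reduce_l _ _ (ve i) vk) ?oppr0// => j.
exact: Qe.
Qed.

End RicciTensor.

(** * Left-invariant frames *)

Section LeftInvariantFrames.
Context {R : realType} {G : lie_group R 3}.
Local Notation vf := ((G -> R) -> G -> R).

Lemma lg_transitive (p q : G) : exists a : G, lg_mul a p = q.
Proof.
have idem (x : G) : lg_mul x x = x -> x = lg_one G.
  move=> xx; rewrite -(lg_mul1 x) -(lg_mulV x) -lg_mulA.
  by rewrite xx lg_mulV.
have mulrV (x : G) : lg_mul x (lg_inv x) = lg_one G.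
  apply: idem.
  by rewrite lg_mulA -(lg_mulA x _ x) lg_mulV -lg_mulA lg_mul1.
have mulr1 (x : G) : lg_mul x (lg_one G) = x.
  by rewrite -(lg_mulV x) lg_mulA mulrV lg_mul1.
by exists (lg_mul q (lg_inv p)); rewrite -lg_mulA lg_mulV mulr1.
Qed.

Definition triple_frame (e1 e2 e3 : vf) (i : 'I_3) : vf :=
  nth 0 [:: e1; e2; e3] i.

Lemma lie_algebra_basis_vf (e1 e2 e3 : vf) : lie_algebra_basis e1 e2 e3 ->
  forall i, vector_field (triple_frame e1 e2 e3 i).
Proof.
by move=> [[[v1 _] [v2 _] [v3 _]] _] [[|[|[|i]]]].
Qed.

(** A combination with constant coefficients that vanishes at one point
vanishes everywhere, since left translations act transitively. *)
Lemma lie_algebra_basis_independent (e1 e2 e3 : vf) :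
  lie_algebra_basis e1 e2 e3 ->
  pointwise_independent (triple_frame e1 e2 e3).
Proof.
move=> basis p v vp; have ve := lie_algebra_basis_vf basis.
have li i : left_invariant (triple_frame e1 e2 e3 i).
  by case: basis => -[l1 l2 l3] _; case: i => [[|[|[|i]]]].
have v0 : \sum_(i < 3) v 0 i *: triple_frame e1 e2 e3 i = 0.
  apply/funext => f; apply/funext => q; rewrite !fct_sumE.
  have [a <-] := lg_transitive p q.
  have [fs|fs] := pselect (smooth f); last first.
    by apply: big1 => i _; rewrite !fctE (ve i).1// /GRing.scale/= mulr0.
  pose fa := fun x => f (lg_mul a x).
  have eq i : triple_frame e1 e2 e3 i f (lg_mul a p) =
      triple_frame e1 e2 e3 i fa p.
    by rewrite ((li i).2 a f fs).
  under eq_bigr do rewrite !fctE eq.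
  have [fas|fas] := pselect (smooth fa); first exact: vp.
  by apply: big1 => i _; rewrite (ve i).1// /GRing.scale/= mulr0.
have li0 : left_invariant (0 : vf) by split=> //; exact: vector_field0.
have [_ /(_ 0 li0)[c [c0 cU]]] := basis.
have E0 : 0 = 0 *: e1 + 0 *: e2 + 0 *: e3 by rewrite !scale0r !addr0.
have Ev : 0 = v 0 (inord 0) *: e1 + v 0 (inord 1) *: e2 + v 0 (inord 2) *: e3.
  rewrite -v0 !big_ord_recl big_ord0 /triple_frame/= addr0 addrA.
  by do ?congr (_ + _); congr (v 0 _ *: _); apply/val_inj; rewrite /= inordK.
have := cU (v 0 (inord 0), v 0 (inord 1), v 0 (inord 2)) Ev.
rewrite (cU (0, 0, 0) E0) => -[h0 h1 h2].
apply/rowP => i; rewrite mxE -(inord_val i).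
by case: i => [[|[|[|i]]]].
Qed.

End LeftInvariantFrames.

(** * Constant coefficients *)

Section ConstantCoefficients.
Context {R : realType} {G : lie_group R 3}.
Local Notation vf := ((G -> R) -> G -> R).
Context (e1 e2 e3 : vf).

(** On these fields the metric, the bracket and the connections act through
their values on the basis, so that identities between them are identities
between polynomials in the coefficients. *)
Definition lcomb (a b c : R) : vf := a *: e1 + b *: e2 + c *: e3.

Lemma lcomb_eq a b c a' b' c' : a = a' -> b = b' -> c = c' ->
  lcomb a b c = lcomb a' b' c'.
Proof. by move=> -> -> ->. Qed.

Lemma lcombB a b c a' b' c' :
  lcomb a b c - lcomb a' b' c' = lcomb (a - a') (b - b') (c - c').
Proof.
by rewrite /lcomb !opprD !scalerBl addrACA; congr (_ + _); rewrite addrACA.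
Qed.

Lemma lcombD a b c a' b' c' :
  lcomb a b c + lcomb a' b' c' = lcomb (a + a') (b + b') (c + c').
Proof. by rewrite /lcomb !scalerDl addrACA; congr (_ + _); rewrite addrACA. Qed.

Lemma lcombN a b c : - lcomb a b c = lcomb (- a) (- b) (- c).
Proof. by rewrite /lcomb !opprD !scaleNr. Qed.

Lemma lcombZ k a b c : k *: lcomb a b c = lcomb (k * a) (k * b) (k * c).
Proof. by rewrite /lcomb !scalerDr !scalerA. Qed.

Lemma lcomb0 : lcomb 0 0 0 = 0.
Proof. by rewrite /lcomb !scale0r !addr0. Qed.

Lemma lcomb1 : lcomb 1 0 0 = e1.
Proof. by rewrite /lcomb !scale0r !addr0 scale1r. Qed.

Lemma lcomb2 : lcomb 0 1 0 = e2.
Proof. by rewrite /lcomb !scale0r addr0 add0r scale1r. Qed.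

Lemma lcomb3 : lcomb 0 0 1 = e3.
Proof. by rewrite /lcomb !scale0r !add0r scale1r. Qed.

Context (v1 : vector_field e1) (v2 : vector_field e2) (v3 : vector_field e3).

Lemma vector_field_lcomb a b c : vector_field (lcomb a b c).
Proof.
by apply: vector_fieldD; [apply: vector_fieldD|]; exact: vector_fieldZ.
Qed.

Lemma bilinear_lcomb (V : lmodType R) (B : vf -> vf -> V) :
  (forall X X' Y, vector_field X -> vector_field X' -> vector_field Y ->
     B (X + X') Y = B X Y + B X' Y) ->
  (forall X Y Y', vector_field X -> vector_field Y -> vector_field Y' ->
     B X (Y + Y') = B X Y + B X Y') ->
  (forall k X Y, vector_field X -> vector_field Y ->
     B (k *: X) Y = k *: B X Y) ->
  (forall k X Y, vector_field X -> vector_field Y ->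
     B X (k *: Y) = k *: B X Y) ->
  forall a1 a2 a3 b1 b2 b3,
  B (lcomb a1 a2 a3) (lcomb b1 b2 b3) =
    a1 *: (b1 *: B e1 e1 + b2 *: B e1 e2 + b3 *: B e1 e3) +
    a2 *: (b1 *: B e2 e1 + b2 *: B e2 e2 + b3 *: B e2 e3) +
    a3 *: (b1 *: B e3 e1 + b2 *: B e3 e2 + b3 *: B e3 e3).
Proof.
move=> BDl BDr BZl BZr a1 a2 a3 b1 b2 b3.
have vb := vector_field_lcomb b1 b2 b3.
have vz (k : R) (X : vf) : vector_field X -> vector_field (k *: X).
  exact: vector_fieldZ.
have Br X : vector_field X -> B X (lcomb b1 b2 b3) =
    b1 *: B X e1 + b2 *: B X e2 + b3 *: B X e3.
  move=> vX; rewrite /lcomb.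
  rewrite (BDr _ _ _ vX (vector_fieldD (vz b1 _ v1) (vz b2 _ v2)) (vz b3 _ v3)).
  rewrite (BDr _ _ _ vX (vz b1 _ v1) (vz b2 _ v2)).
  by rewrite (BZr _ _ _ vX v1) (BZr _ _ _ vX v2) (BZr _ _ _ vX v3).
rewrite {1}/lcomb.
rewrite (BDl _ _ _ (vector_fieldD (vz a1 _ v1) (vz a2 _ v2)) (vz a3 _ v3) vb).
rewrite (BDl _ _ _ (vz a1 _ v1) (vz a2 _ v2) vb).
rewrite (BZl _ _ _ v1 vb) (BZl _ _ _ v2 vb) (BZl _ _ _ v3 vb).
by rewrite (Br _ v1) (Br _ v2) (Br _ v3).
Qed.

End ConstantCoefficients.

(** * The group G_4 *)

Section PseudoOrthonormalFrame.
Context {R : realType} {G : lie_group R 3}.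
Local Notation vf := ((G -> R) -> G -> R).
Context (g : vf -> vf -> G -> R) (g_lorentzian : lorentzian g).
Context (e1 e2 e3 : vf) (e_basis : lie_algebra_basis e1 e2 e3).
Context (e_orth : pseudo_orthonormal g e1 e2 e3).

Let gt : tensor02 g. Proof. by case: g_lorentzian. Qed.
Let g_sym X Y : vector_field X -> vector_field Y -> g X Y = g Y X.
Proof. by case: g_lorentzian => _ + _; apply. Qed.
Let v1 : vector_field e1. Proof. by case: e_basis => -[[]]. Qed.
Let v2 : vector_field e2. Proof. by case: e_basis => -[_ []]. Qed.
Let v3 : vector_field e3. Proof. by case: e_basis => -[_ _ []]. Qed.

Lemma metric_lcomb a1 a2 a3 b1 b2 b3 :
  g (lcomb e1 e2 e3 a1 a2 a3) (lcomb e1 e2 e3 b1 b2 b3) =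
  cst (a1 * b1 + a2 * b2 - a3 * b3).
Proof.
rewrite (bilinear_lcomb v1 v2 v3 (tensorDl gt) (tensorDr gt) (tensorZl gt)
  (tensorZr gt)).
have [[-> -> ->] [[-> -> ->] [-> -> ->]]] := e_orth.
rewrite !scaler0 !addr0 !add0r.
apply/funext => p; rewrite !fctE /GRing.scale/=; ring.
Qed.

Lemma metric_fscale_sum f1 f2 f3 : smooth f1 -> smooth f2 -> smooth f3 ->
  let Z := fscale f1 e1 + fscale f2 e2 + fscale f3 e3 in
  [/\ g Z e1 = f1, g Z e2 = f2 & g Z e3 = - f3].
Proof.
move=> s1 s2 s3 /=.
have vf1 := vector_field_fscale s1 v1; have vf2 := vector_field_fscale s2 v2.
have vf3 := vector_field_fscale s3 v3; have vf12 := vector_fieldD vf1 vf2.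
have gE e : vector_field e ->
    g (fscale f1 e1 + fscale f2 e2 + fscale f3 e3) e =
    f1 * g e1 e + f2 * g e2 e + f3 * g e3 e.
  move=> ve; rewrite (tensorDl gt vf12 vf3 ve) (tensorDl gt vf1 vf2 ve).
  rewrite (tensor_fscalel gt s1 v1 ve) (tensor_fscalel gt s2 v2 ve).
  by rewrite (tensor_fscalel gt s3 v3 ve).
rewrite (gE _ v1) (gE _ v2) (gE _ v3).
have [[-> -> ->] [[-> -> ->] [-> -> ->]]] := e_orth.
rewrite !mulr0 !addr0 !add0r.
by split; apply/funext => p; rewrite !fctE; ring.
Qed.

Lemma pseudo_orthonormal_expansion Z : vector_field Z ->
  Z = fscale (g Z e1) e1 + fscale (g Z e2) e2 + fscale (- g Z e3) e3.
Proof.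
move=> vZ.
have [z [zs ZE]] := frame_expansion (lie_algebra_basis_vf e_basis)
  (lie_algebra_basis_independent e_basis) vZ.
move: ZE; rewrite !big_ord_recl big_ord0 addr0 addrA /triple_frame/= => ZE.
have [] := metric_fscale_sum (zs ord0) (zs (lift ord0 ord0))
  (zs (lift ord0 (lift ord0 ord0))).
by rewrite -ZE => -> -> ->; rewrite opprK.
Qed.

Let D : set vf := sections_span [:: e1; e2].
Let D' : set vf := sections_span [:: e3].

Lemma sections_span2 f1 f2 : smooth f1 -> smooth f2 ->
  D (fscale f1 e1 + fscale f2 e2).
Proof.
move=> s1 s2; exists (fun i : 'I_2 => if i == ord0 then f1 else f2); split.
  by move=> i; case: ifP.
by rewrite !big_ord_recl big_ord0 /= addr0.
Qed.

Lemma sections_span1 f : smooth f -> D' (fscale f e3).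
Proof.
by move=> s; exists (fun=> f); split=> //; rewrite big_ord_recl big_ord0 addr0.
Qed.

(** Both projections are read off from scalar products, which also shows that
the decomposition along the two distributions is unique. *)
Lemma proj_alongE Z : vector_field Z ->
  proj_along D D' Z = fscale (g Z e1) e1 + fscale (g Z e2) e2 /\
  proj_along D' D Z = fscale (- g Z e3) e3.
Proof.
move=> vZ; have ZE := pseudo_orthonormal_expansion vZ.
have s1 := tensor_smooth gt vZ v1; have s2 := tensor_smooth gt vZ v2.
have s3 := smoothN (tensor_smooth gt vZ v3).
have split_uniq Y Y' : D Y -> D' Y' -> Z = Y + Y' ->
    Y = fscale (g Z e1) e1 + fscale (g Z e2) e2 /\ Y' = fscale (- g Z e3) e3.
  move=> [f [fs YE]] [h [hs YE']].
  move: YE YE'; rewrite !big_ord_recl !big_ord0 !addr0 /= => YE YE' ZYY'.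
  have [] := metric_fscale_sum (fs ord0) (fs (lift ord0 ord0)) (hs ord0).
  by rewrite -YE -YE' -ZYY' => -> -> ->; rewrite opprK.
split; rewrite /proj_along; case: xgetP => [Y _ [DY DY']|noY].
- by have [] := split_uniq Y (Z - Y) DY DY'; rewrite // addrC subrK.
- case: (noY (fscale (g Z e1) e1 + fscale (g Z e2) e2)); split.
    exact: sections_span2.
  by rewrite [X in X - _]ZE addrAC subrr add0r; exact: sections_span1.
- by have [] := split_uniq (Z - Y) Y DY' DY; rewrite // subrK.
- case: (noY (fscale (- g Z e3) e3)); split; first exact: sections_span1.
  by rewrite [X in X - _]ZE addrK; exact: sections_span2.
Qed.

Lemma proj_along_lcomb a b c :
  proj_along D D' (lcomb e1 e2 e3 a b c) = lcomb e1 e2 e3 a b 0 /\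
  proj_along D' D (lcomb e1 e2 e3 a b c) = lcomb e1 e2 e3 0 0 c.
Proof.
have [-> ->] := proj_alongE (vector_field_lcomb v1 v2 v3 a b c).
have -> : g (lcomb e1 e2 e3 a b c) e1 = cst a.
  by rewrite -[X in g _ X](lcomb1 e1 e2 e3) metric_lcomb; congr cst; ring.
have -> : g (lcomb e1 e2 e3 a b c) e2 = cst b.
  by rewrite -[X in g _ X](lcomb2 e1 e2 e3) metric_lcomb; congr cst; ring.
have -> : - g (lcomb e1 e2 e3 a b c) e3 = cst c.
  rewrite -[X in g _ X](lcomb3 e1 e2 e3) metric_lcomb.
  by apply/funext => p; rewrite !fctE; ring.
by rewrite /lcomb !scale0r addr0 !add0r.
Qed.



Section BottConnection.
Context (alpha beta eta : R).
Local Notation gamma := (2 * eta - beta).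
Local Notation L := (lcomb e1 e2 e3).
Context (bracket12 : lie_bracket e1 e2 = - e2 + gamma *: e3).
Context (bracket13 : lie_bracket e1 e3 = - beta *: e2 + e3).
Context (bracket23 : lie_bracket e2 e3 = alpha *: e1).
Context (nablaL : vf -> vf -> vf) (nablaL_lc : levi_civita g nablaL).

Let br12 : lie_bracket e1 e2 = L 0 (-1) gamma.
Proof. by rewrite bracket12 /lcomb scale0r add0r scaleN1r. Qed.
Let br13 : lie_bracket e1 e3 = L 0 (- beta) 1.
Proof. by rewrite bracket13 /lcomb scale0r add0r scale1r. Qed.
Let br23 : lie_bracket e2 e3 = L alpha 0 0.
Proof. by rewrite bracket23 /lcomb !scale0r !addr0. Qed.
Let br21 : lie_bracket e2 e1 = L 0 1 (- gamma).
Proof. by rewrite lie_bracketC br12 lcombN oppr0 opprK. Qed.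
Let br31 : lie_bracket e3 e1 = L 0 beta (-1).
Proof. by rewrite lie_bracketC br13 lcombN oppr0 opprK. Qed.
Let br32 : lie_bracket e3 e2 = L (- alpha) 0 0.
Proof. by rewrite lie_bracketC br23 lcombN oppr0. Qed.

Lemma lie_bracket_diag (X : vf) : lie_bracket X X = 0.
Proof. by apply/funext => f; rewrite /lie_bracket subrr. Qed.

Lemma lie_bracket_lcomb a1 a2 a3 b1 b2 b3 :
  lie_bracket (L a1 a2 a3) (L b1 b2 b3) =
  L (alpha * (a2 * b3 - a3 * b2))
    (- (a1 * b2 - a2 * b1) - beta * (a1 * b3 - a3 * b1))
    (gamma * (a1 * b2 - a2 * b1) + (a1 * b3 - a3 * b1)).
Proof.
rewrite (bilinear_lcomb v1 v2 v3 (@lie_bracketDl _ _ _) (@lie_bracketDr _ _ _)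
  (@lie_bracketZl _ _ _) (@lie_bracketZr _ _ _)).
rewrite !lie_bracket_diag br12 br13 br21 br23 br31 br32.
rewrite -(lcomb0 e1 e2 e3) !(lcombZ e1 e2 e3, lcombD e1 e2 e3).
by apply: lcomb_eq; ring.
Qed.

Let bracket_closed (X Y : vf) : vector_field X -> vector_field Y ->
  vector_field (lie_bracket X Y).
Proof.
apply: (vector_field_bracket (lie_algebra_basis_vf e_basis)
  (lie_algebra_basis_independent e_basis)).
have vL := vector_field_lcomb v1 v2 v3; have v0 := @vector_field0 R 3 G.
by case=> [[|[|[|i]]]] //= hi; case=> [[|[|[|j]]]] //= hj;
  rewrite /triple_frame/=
  ?lie_bracket_diag ?br12 ?br13 ?br23 ?br21 ?br31 ?br32.
Qed.

Let nablaL_conn : linear_connection nablaL.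
Proof. by case: nablaL_lc. Qed.

(** The derivative of the constant [g Y Z] vanishes, so that compatibility with
the metric is antisymmetry in [Y] and [Z]. *)
Lemma levi_civita_skew X Y Z k : vector_field X -> vector_field Y ->
  vector_field Z -> g Y Z = cst k ->
  g (nablaL X Y) Z = - g (nablaL X Z) Y.
Proof.
move=> vX vY vZ gYZ; have [_ _ /(_ X Y Z vX vY vZ)] := nablaL_lc.
rewrite /cov_deriv gYZ (vf_fct_cst _ vX) sub0r.
rewrite (g_sym vY (vector_field_conn nablaL_conn vX vZ)) => /subr0_eq <-.
by rewrite opprK.
Qed.

Lemma levi_civita_skew_diag X Y k : vector_field X -> vector_field Y ->
  g Y Y = cst k -> g (nablaL X Y) Y = 0.
Proof.
move=> vX vY gYY; have /funeqP := levi_civita_skew vX vY vY gYY.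
move=> gN; apply/funext => p; have := gN p; rewrite !fctE.
move=> gNp; change (g (nablaL X Y) Y p = 0); lra.
Qed.

Lemma levi_civita_torsion_free X Y : vector_field X -> vector_field Y ->
  nablaL X Y = nablaL Y X + lie_bracket X Y.
Proof.
move=> vX vY; have [_ /(_ X Y vX vY) + _] := nablaL_lc.
by rewrite /torsion -addrA -opprD => /subr0_eq.
Qed.

Context (nablaB : vf -> vf -> vf).
Context (nablaB_bott : bott_connection nablaL D D' nablaB).

Let nablaB_conn : linear_connection nablaB.
Proof. by case: nablaB_bott. Qed.

Let D1 : D e1.
Proof.
have := sections_span2 (@smooth_cst _ _ G 1) (@smooth_cst _ _ G 0).
by rewrite !fscale_cst scale1r scale0r addr0.
Qed.
Let D2 : D e2.
Proof.
have := sections_span2 (@smooth_cst _ _ G 0) (@smooth_cst _ _ G 1).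
by rewrite !fscale_cst scale1r scale0r add0r.
Qed.
Let D'3 : D' e3.
Proof.
have := sections_span1 (@smooth_cst _ _ G 1).
by rewrite !fscale_cst scale1r.
Qed.

(** Of the Levi-Civita connection only the components along [e1] and [e2] of
[nablaL X Y], for [X] and [Y] among [e1] and [e2], and the one along [e3] of
[nablaL e3 e3] contribute. By antisymmetry the components of [nablaL X Y] along
[Y] vanish; the remaining ones then follow from [lie_bracket e1 e2]. *)
Lemma bott_basis :
  [/\ nablaB e1 e1 = L 0 0 0, nablaB e1 e2 = L 0 0 0
    & nablaB e1 e3 = L 0 0 1] /\
  [/\ nablaB e2 e1 = L 0 1 0, nablaB e2 e2 = L (-1) 0 0
    & nablaB e2 e3 = L 0 0 0] /\
  [/\ nablaB e3 e1 = L 0 beta 0, nablaB e3 e2 = L (- alpha) 0 0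
    & nablaB e3 e3 = L 0 0 0].
Proof.
have [_ BDD BD'D BDD' BD'D'] := nablaB_bott.
have vL := vector_field_conn nablaL_conn.
have [[g11 g22 g33] [[g12 _ _] [g21 _ _]]] := e_orth.
have l111 := levi_civita_skew_diag v1 v1 g11.
have l122 := levi_civita_skew_diag v1 v2 g22.
have l211 := levi_civita_skew_diag v2 v1 g11.
have l222 := levi_civita_skew_diag v2 v2 g22.
have l333 := levi_civita_skew_diag v3 v3 g33.
have vbr := vector_field_lcomb v1 v2 v3 0 (-1) gamma.
have l12 e : vector_field e -> g (nablaL e1 e2) e =
    g (nablaL e2 e1) e + g (L 0 (-1) gamma) e.
  move=> ve; rewrite (levi_civita_torsion_free v1 v2) br12.
  by rewrite (tensorDl gt (vL _ _ v2 v1) vbr ve).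
have l121 : g (nablaL e1 e2) e1 = 0.
  rewrite (l12 _ v1) l211 add0r -[X in g _ X](lcomb1 e1 e2 e3) metric_lcomb.
  by apply/funext => p; rewrite !fctE -[RHS]/(0 : R); ring.
have l212 : g (nablaL e2 e1) e2 = cst 1.
  have gbr : g (L 0 (-1) gamma) e2 = cst (-1).
    by rewrite -[X in g _ X](lcomb2 e1 e2 e3) metric_lcomb; congr cst; ring.
  apply/funext => p; have /funeqP/(_ p) := l12 _ v2; rewrite l122 gbr.
  change (0 = g (nablaL e2 e1) e2 p + -1 -> g (nablaL e2 e1) e2 p = 1) => ?.
  lra.
have l112 : g (nablaL e1 e1) e2 = 0.
  by rewrite (levi_civita_skew v1 v1 v2 g12) l121 oppr0.
have l221 : g (nablaL e2 e2) e1 = cst (-1).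
  by rewrite (levi_civita_skew v2 v2 v1 g21) l212.
have pD Z : vector_field Z ->
    proj_along D D' Z = fscale (g Z e1) e1 + fscale (g Z e2) e2.
  by move=> /proj_alongE[].
split; [split|split; split].
- rewrite (BDD _ _ D1 D1) (pD _ (vL _ _ v1 v1)) l111 l112.
  by rewrite !fscale0l addr0 lcomb0.
- rewrite (BDD _ _ D1 D2) (pD _ (vL _ _ v1 v2)) l121 l122.
  by rewrite !fscale0l addr0 lcomb0.
- by rewrite (BDD' _ _ D1 D'3) br13 (proj_along_lcomb _ _ _).2.
- rewrite (BDD _ _ D2 D1) (pD _ (vL _ _ v2 v1)) l211 l212.
  by rewrite fscale0l add0r fscale_cst scale1r lcomb2.
- rewrite (BDD _ _ D2 D2) (pD _ (vL _ _ v2 v2)) l221 l222.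
  by rewrite fscale0l addr0 fscale_cst /lcomb !scale0r !addr0.
- by rewrite (BDD' _ _ D2 D'3) br23 (proj_along_lcomb _ _ _).2.
- by rewrite (BD'D _ _ D'3 D1) br31 (proj_along_lcomb _ _ _).1.
- by rewrite (BD'D _ _ D'3 D2) br32 (proj_along_lcomb _ _ _).1.
- rewrite (BD'D' _ _ D'3 D'3) (proj_alongE (vL _ _ v3 v3)).2 l333.
  by rewrite oppr0 fscale0l lcomb0.
Qed.

Lemma bott_lcomb a1 a2 a3 b1 b2 b3 :
  nablaB (L a1 a2 a3) (L b1 b2 b3) =
  L (- (a2 * b2) - alpha * (a3 * b2)) (a2 * b1 + beta * (a3 * b1)) (a1 * b3).
Proof.
rewrite (bilinear_lcomb v1 v2 v3 (connDl nablaB_conn) (connDr nablaB_conn)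
  (connZl nablaB_conn) (connZr nablaB_conn)).
have [[-> -> ->] [[-> -> ->] [-> -> ->]]] := bott_basis.
by rewrite !(lcombZ e1 e2 e3, lcombD e1 e2 e3); apply: lcomb_eq; ring.
Qed.

Local Notation rho := (sym_ricci g e1 e2 e3 nablaB).

(** The only nonzero off-diagonal component of the Ricci tensor is alpha, at
(e2, e3); symmetrizing it gives the coefficient alpha / 2. *)
Lemma sym_ricci_lcomb a1 a2 a3 b1 b2 b3 :
  rho (L a1 a2 a3) (L b1 b2 b3) =
  cst ((beta * gamma - 1) * (a1 * b1) + (alpha * gamma - 1) * (a2 * b2)
       + alpha / 2 * (a2 * b3 + a3 * b2)).
Proof.
have curvE a1' a2' a3' b1' b2' b3' (e : vf) c1 c2 c3 : e = L c1 c2 c3 ->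
    g (curvature nablaB (L a1' a2' a3') e (L b1' b2' b3')) e =
    g (curvature nablaB (L a1' a2' a3') (L c1 c2 c3) (L b1' b2' b3'))
      (L c1 c2 c3).
  by move=> ->.
rewrite /sym_ricci /ricci.
rewrite !(curvE _ _ _ _ _ _ e1 _ _ _ (esym (lcomb1 e1 e2 e3))).
rewrite !(curvE _ _ _ _ _ _ e2 _ _ _ (esym (lcomb2 e1 e2 e3))).
rewrite !(curvE _ _ _ _ _ _ e3 _ _ _ (esym (lcomb3 e1 e2 e3))).
rewrite /curvature !(lie_bracket_lcomb, bott_lcomb) !(lcombB e1 e2 e3).
rewrite !metric_lcomb.
apply/funext => p; rewrite !fctE /GRing.scale/=; by field.
Qed.

(** The components of [rho] are constant, so the terms with derivatives of
[rho Y Z] and [rho X Z] vanish, and the torsion cancels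
[rho (nablaB X Y) Z - rho (nablaB Y X) Z]. What is left is
[rho X (nablaB Y Z) - rho Y (nablaB X Z) - rho (lie_bracket X Y) Z]. *)
Lemma quasi_statistical_defect a1 a2 a3 b1 b2 b3 c1 c2 c3 :
  let X := L a1 a2 a3 in let Y := L b1 b2 b3 in let Z := L c1 c2 c3 in
  cov_deriv nablaB rho X Y Z - cov_deriv nablaB rho Y X Z
    + rho (torsion nablaB X Y) Z =
  cst ((alpha / 2 - beta) * (gamma * (a1 * b2 - a2 * b1) * c2
         + (a1 * b3 - a3 * b1) * c2 + (a2 * b3 - a3 * b2) * c1)
       + alpha * beta / 2 * (a1 * b3 - a3 * b1) * c3).
Proof.
move=> X Y Z; rewrite {}/X {}/Y {}/Z.
have vL := vector_field_lcomb v1 v2 v3.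
rewrite /cov_deriv /torsion !(lie_bracket_lcomb, bott_lcomb) !(lcombB e1 e2 e3).
rewrite !sym_ricci_lcomb !(vf_fct_cst _ (vL _ _ _)) !sub0r.
by apply/funext => p; rewrite !fctE; field.
Qed.

Lemma quasi_statistical_bott :
  quasi_statistical nablaB rho <-> alpha = 0 /\ beta = 0.
Proof.
have vL := vector_field_lcomb v1 v2 v3; split=> [qs|[alpha0 beta0]].
  have defect0 b1 b2 b3 c1 c2 c3 a1 a2 a3 :
      (alpha / 2 - beta) * (gamma * (a1 * b2 - a2 * b1) * c2
         + (a1 * b3 - a3 * b1) * c2 + (a2 * b3 - a3 * b2) * c1)
       + alpha * beta / 2 * (a1 * b3 - a3 * b1) * c3 = 0.
    have := qs _ _ _ (vL a1 a2 a3) (vL b1 b2 b3) (vL c1 c2 c3).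
    by rewrite quasi_statistical_defect => /funeqP/(_ (lg_one G)).
  (* the components at (e1, e3, e2) and (e1, e3, e3): these are
     alpha / 2 - beta and alpha beta / 2 *)
  have h132 := defect0 0 0 1 0 1 0 1 0 0.
  have h133 := defect0 0 0 1 0 0 1 1 0 0.
  have alphaE : alpha = 2 * beta by lra.
  have beta2 : beta ^+ 2 = 0 by move: h133; rewrite alphaE; nra.
  move/eqP: beta2; rewrite sqrf_eq0 => /eqP beta0.
  by rewrite alphaE beta0 mulr0.
have wt := tensor02_sym_ricci nablaB_conn bracket_closed gt v1 v2 v3.
apply: (quasi_statistical_frame nablaB_conn bracket_closed
  (lie_algebra_basis_vf e_basis) (lie_algebra_basis_independent e_basis) wt).
have eL i : exists a b c, triple_frame e1 e2 e3 i = L a b c.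
  case: i => [[|[|[|i]]] hi] //; rewrite /triple_frame/=.
  - by exists 1, 0, 0; rewrite lcomb1.
  - by exists 0, 1, 0; rewrite lcomb2.
  - by exists 0, 0, 1; rewrite lcomb3.
move=> i j k; have [a1 [a2 [a3 ->]]] := eL i; have [b1 [b2 [b3 ->]]] := eL j.
have [c1 [c2 [c3 ->]]] := eL k; rewrite quasi_statistical_defect alpha0 beta0.
by rewrite !(mul0r, subr0, addr0).
Qed.

End BottConnection.
End PseudoOrthonormalFrame.

Theorem theorem3p5 (R : realType) (alpha beta eta : R)
    (eta_pm1 : eta = 1 \/ eta = -1)
    (G : lie_group R 3)
    (G_connected : connected [set: G])
    (G_simply_connected : simply_connected R G)
    (g : ((G -> R) -> G -> R) -> ((G -> R) -> G -> R) -> G -> R)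
    (g_lorentzian : lorentzian g)
    (g_left_invariant : left_invariant_metric g)
    (e1 e2 e3 : (G -> R) -> G -> R)
    (e_basis : lie_algebra_basis e1 e2 e3)
    (e_pseudo_orthonormal : pseudo_orthonormal g e1 e2 e3)
    (bracket12 : lie_bracket e1 e2 = - e2 + (2 * eta - beta) *: e3)
    (bracket13 : lie_bracket e1 e3 = - beta *: e2 + e3)
    (bracket23 : lie_bracket e2 e3 = alpha *: e1)
    (nablaL : ((G -> R) -> G -> R) -> ((G -> R) -> G -> R) -> (G -> R) -> G -> R)
    (nablaL_levi_civita : levi_civita g nablaL)
    (nablaB : ((G -> R) -> G -> R) -> ((G -> R) -> G -> R) -> (G -> R) -> G -> R)
    (nablaB_bott : bott_connection nablaL
       (sections_span [:: e1; e2]) (sections_span [:: e3]) nablaB) :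
  quasi_statistical nablaB (sym_ricci g e1 e2 e3 nablaB)
  <-> alpha = 0 /\ beta = 0.
Proof.
exact: (quasi_statistical_bott g_lorentzian e_basis e_pseudo_orthonormal
  bracket12 bracket13 bracket23 nablaL_levi_civita nablaB_bott).
Qed.
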